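(* Let $G$ be an amenable unimodular lcsc group with Haar measure $m_G$. Suppose that $\Lambda$ is a weighted Delone set in $G$ that is almost tempered repetitive with respect to a strong Følner exhaustion sequence $(T_m)$ of $G$. Then the Banach density $$b_\Lambda:=\lim_{m\to\infty}\frac{\delta_\Pi(T_m^{-1})}{m_G(T_m)}$$ exists uniformly in $\Pi\in\mathcal H_\Lambda$; that is, there is a real number $b_\Lambda$ with $\lim_{m\to\infty}\sup_{\Pi\in\mathcal H_\Lambda}\left|\frac{\delta_\Pi(T_m^{-1})}{m_G(T_m)}-b_\Lambda\right|=0$.
   Context: lcsc = locally compact second countable; $e$ is the identity. A subset $P\subseteq G$ is Delone if there are a nonempty open relatively compact $U\subseteq G$ with $\#(gU\cap P)\le 1$ for all $g\in G$ and a compact $K\subseteq G$ with $PK=G$. A weighted Delone set is a pair $\Lambda=(P,\alpha)$ with $P$ Delone and $\alpha:P\to[\sigma^{-1},\sigma]$ for some $\sigma\ge1$; it is identified with the Radon measure (Dirac comb) $\delta_\Lambda=\sum_{x\in P}\alpha(x)\delta_x$. $G$ acts by $g.(P,\alpha)=(gP,\alpha(g^{-1}\,\cdot))$. The hull $\mathcal H_\Lambda$ is the closure of $\{g.\Lambda:g\in G\}$ in the space of Radon measures with the weak-$*$ topology (tested against $C_c(G)$); all its elements are Dirac combs of weighted Delone sets. Fix a continuous adapted metric $d$ on $G$ (left-invariant, proper, i.e. balls are relatively compact, and locally bounded; one always exists) with open balls $B_\delta(y)$. For relatively compact $S\subseteq G$ and Radon measures $\mu,\nu$ put $d_S(\mu,\nu)=\inf\{\delta>0: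 |\mu(B_\delta(y))-\nu(B_\delta(y))|<\delta\ \text{for all } y\in S\cap(\operatorname{supp}\mu\cup\operatorname{supp}\nu)\}$. The $S$-patch of $\Lambda$ is $(\delta_\Lambda|_S,S)$; patches are equivalent if one is a translate $(g_*\mu,gS)$ of the other $(\mu,S)$; a pattern of size $S$ is the equivalence class of a patch whose support is a translate of $S$. For $\delta>0$ the pattern of a patch $(\mu,S)$ $\delta$-occurs in $T$ if there is $g\in G$ with $gS\subseteq T$ and $d_{gS}(g_*\mu,\delta_\Lambda|_{gS})<\delta$. For relatively compact $L,S$ put $\partial_L(S)=\{g\in G: Lg\cap S\ne\emptyset \text{ and } Lg\cap(G\setminus S)\neq\emptyset\}$. A strong Følner exhaustion sequence is a sequence $\mathcal T=(T_m)_{m\in\mathbb N}$ of compact sets of positive Haar measure which is a Følner sequence ($m_G(T_m\triangle KT_m)/m_G(T_m)\to0$ for all nonempty compact $K$), satisfies $m_G(\partial_K(T_m))/m_G(T_m)\to0$ for all compact $K$, and satisfies $e\in T_m\subseteq\mathring T_{m+1}$ and $\bigcup_mT_m=G$. For $\delta>0$, $m\in\mathbb N$ let $\mathcal R^{\mathcal T}_\Lambda(\delta,m)\in\mathbb N\cup\{\infty\}$ be the infimum of all $n\in\mathbb N$ such that every pattern of $\Lambda$ of size $\mathring T_m^{-1}$ $\delta$-occurs in $h\mathring T_n^{-1}$ for all $h\in G$ ($\inf\emptyset=\infty$). Put $\zeta(\delta)=\inf_{m} m_G(T_m)/m_G(T_{\mathcal R^{\mathcal T}_\Lambda(\delta,m)})$,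 with $\zeta(\delta)=0$ if $\mathcal R^{\mathcal T}_\Lambda(\delta,m)=\infty$ for some $m$. $\Lambda$ is almost tempered repetitive with respect to $\mathcal T$ if $\zeta(\delta)>0$ for all $\delta\in(0,1)$. *)

(* Defs.v *)
From HB Require Import structures.
From mathcomp Require Import all_boot all_order all_algebra finmap.
From mathcomp Require Import all_classical all_reals all_analysis.

Set Implicit Arguments.
Unset Strict Implicit.
Unset Printing Implicit Defensive.
Import Order.TTheory GRing.Theory Num.Theory.
Import numFieldNormedType.Exports.
Local Open Scope classical_set_scope.
Local Open Scope ring_scope.

(* Topological groups, written multiplicatively. The distinguished point (an
   arbitrary element) is only there because the measurable types of the
   library are pointed. *)
HB.mixin Record PTopologicalGroup_isTopGroup G
    of PointedTopological G & monoid.Group G := {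
  mulg_continuous : continuous (fun p : G * G => (p.1 * p.2)%g);
  invg_continuous : continuous (fun x : G => (x^-1)%g) }.

#[short(type="topGroupType")]
HB.structure Definition TopGroup :=
  {G of PointedTopological G & monoid.Group G & PTopologicalGroup_isTopGroup G}.

Definition lcsc (G : topGroupType) :=
  [/\ hausdorff_space G, locally_compact [set: G] & @second_countable G].

Section SetOps.
Variable G : topGroupType.
Implicit Types (A B : set G) (g : G).

Definition mulset A B : set G := [set (a * b)%g | a in A & b in B].
Definition invset A : set G := [set (a^-1)%g | a in A].
Definition ltrans g A : set G := [set (g * a)%g | a in A].
Definition rtrans A g : set G := [set (a * g)%g | a in A].

Lemma ltransE g A : ltrans g A = [set x | A (g^-1 * x)%g].
Proof.
apply/seteqP; split=> [_ [a Aa <-]/=|x /= Ax]; first by rewrite mulKg.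
by exists (g^-1 * x)%g => //; rewrite mulVKg.
Qed.

Lemma ltransM g h A : ltrans g (ltrans h A) = ltrans (g * h)%g A.
Proof. by apply/seteqP; split => x; rewrite !ltransE/= invgM mulgA. Qed.

Lemma lmul_continuous g : continuous (fun x : G => (g * x)%g).
Proof.
move=> x; apply: (@continuous_comp _ _ _ (fun x : G => (g, x))
  (fun p : G * G => (p.1 * p.2)%g)); last exact: mulg_continuous.
by apply: cvg_pair => //=; exact: cvg_cst.
Qed.

Lemma open_ltrans g A : open A -> open (ltrans g A).
Proof.
rewrite ltransE => oA; apply: (@open_comp _ _ (fun x : G => (g^-1 * x)%g)) => //.
by move=> x _; exact: lmul_continuous.
Qed.

Lemma compact_ltrans g A : compact A -> compact (ltrans g A).
Proof.
move=> cA; apply: continuous_compact => //.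
by apply: continuous_subspaceT => x; exact: lmul_continuous.
Qed.

End SetOps.

Definition borel (G : topGroupType) := g_sigma_algebraType (@open G).

Lemma measurable_lmul (G : topGroupType) (g : G) :
  measurable_fun [set: borel G] ((fun x => (g * x)%g) : borel G -> borel G).
Proof.
apply: (@measurability _ _ (borel G) (borel G) _ _ (@open G)) => //.
move=> _ [B oB <-]; rewrite setTI; apply: sub_sigma_algebra.
by apply: open_comp => // x _; exact: lmul_continuous.
Qed.

(* Positive Borel measures which are finite on compact sets; on a lcsc space
   they are automatically inner and outer regular. *)
Record radon (R : realType) (G : topGroupType) := Radon {
  radon_measure :> {measure set (borel G) -> \bar R};
  radon_compact : forall K : set G, compact K -> (radon_measure K < +oo)%E }.

Record Cc (R : realType) (G : topGroupType) := MkCc {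
  Cc_fun :> G -> R;
  Cc_continuous : continuous Cc_fun;
  Cc_support : compact (closure [set x | Cc_fun x != 0]) }.

HB.instance Definition _ (R : realType) (G : topGroupType) :=
  gen_eqMixin (Cc R G).
HB.instance Definition _ (R : realType) (G : topGroupType) :=
  gen_choiceMixin (Cc R G).

Definition radon_pairing (R : realType) (G : topGroupType) (mu : radon R G) :
  {ptws Cc R G -> R} := fun f => (\int[mu]_x f x)%R.

HB.instance Definition _ (R : realType) (G : topGroupType) :=
  gen_eqMixin (radon R G).
HB.instance Definition _ (R : realType) (G : topGroupType) :=
  gen_choiceMixin (radon R G).
(* The initial topology of the pairing with C_c(G), that is, weak-*. *)
HB.instance Definition _ (R : realType) (G : topGroupType) :=
  Topological.copy (radon R G) (initial_topology (@radon_pairing R G)).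


Section Push.
Variables (R : realType) (G : topGroupType) (mu : radon R G) (g : G).

Definition push_fun : set (borel G) -> \bar R :=
  pushforward mu ((fun x => (g * x)%g) : borel G -> borel G).

Let push0 : push_fun set0 = 0%E.
Proof. by rewrite /push_fun /pushforward preimage_set0 measure0. Qed.

Let push_ge0 A : (0 <= push_fun A)%E.
Proof. by rewrite /push_fun /pushforward measure_ge0. Qed.

Let push_sigma_additive : semi_sigma_additive push_fun.
Proof.
have mpre A : measurable A ->
    measurable (((fun x => (g * x)%g) : borel G -> borel G) @^-1` A).
  by move=> mA; rewrite -[X in measurable X]setTI; exact: measurable_lmul.
move=> F mF tF mUF; rewrite /push_fun /pushforward preimage_bigcup.
apply: measure_semi_sigma_additive.
- by move=> n; exact: mpre.
- apply/trivIsetP => /= i j _ _ ij; rewrite -preimage_setI.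
  by move/trivIsetP : tF => /(_ _ _ _ _ ij) ->//; rewrite preimage_set0.
- by rewrite -preimage_bigcup; exact: mpre.
Qed.

HB.instance Definition _ := isMeasure.Build _ _ _ push_fun
  push0 push_ge0 push_sigma_additive.

Let push_compact (K : set G) : compact K -> (push_fun K < +oo)%E.
Proof.
move=> cK; rewrite /push_fun /pushforward.
have -> : (fun x : G => (g * x)%g) @^-1` K = ltrans g^-1%g K.
  by rewrite ltransE invgK.
by apply: radon_compact; exact: compact_ltrans.
Qed.

Definition push : radon R G := Radon push_compact.

End Push.

Definition delone (G : topGroupType) (P : set G) :=
  (exists U : set G, [/\ open U, U !=set0, precompact U &
     forall g, is_subset1 (ltrans g U `&` P)]) /\
  (exists2 K : set G, compact K & mulset P K = [set: G]).

(* Only the values of [wt] on [pts] are relevant. *)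
Record wdelone (R : realType) (G : topGroupType) := WDelone {
  pts : set G;
  wt : G -> R;
  pts_delone : delone pts;
  wt_bounded : exists2 s : R, 1 <= s & forall x, pts x -> s^-1 <= wt x <= s }.

Section Comb.
Variables (R : realType) (G : topGroupType) (L : wdelone R G) (S : set G).

Lemma wt_gt0 x : pts L x -> 0 < wt L x.
Proof.
have [s s1 sL] := wt_bounded L => /sL /andP[+ _]; apply: lt_le_trans.
by rewrite invr_gt0 (lt_le_trans _ s1).
Qed.

Lemma finite_pts (K : set G) : compact K -> finite_set (pts L `&` K).
Proof.
rewrite compact_cover => cK; have [[U [oU [u0 Uu0] _ U1]] _] := pts_delone L.
have [|x Kx|D _ KD] := cK G setT (fun g => ltrans g U).
- by move=> g _; exact: open_ltrans.
- by exists (x * u0^-1)%g => //; exists u0 => //; rewrite mulgVK.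
apply: (@sub_finite_set _ _ (\bigcup_(g in [set` D]) (ltrans g U `&` pts L))).
  by move=> x [Px /KD[g Dg gUx]]; exists g.
apply: bigcup_finite => // g _.
have [[x Ax]|] := pselect (exists x, (ltrans g U `&` pts L) x); last first.
  by move=> /forallNP A0; rewrite (_ : _ `&` _ = set0)//; apply/seteqP; split.
apply: (@sub_finite_set _ _ [set x]) => // y Ay; exact: (U1 g).
Qed.

Definition comb_fun (A : set (borel G)) : \bar R :=
  (\esum_(x in pts L `&` S `&` A) (wt L x)%:E)%E.

Let comb0 : comb_fun set0 = 0%E.
Proof. by rewrite /comb_fun setI0 esum_set0. Qed.

Let comb_ge0 A : (0 <= comb_fun A)%E.
Proof. by apply: esum_ge0 => x [[Px _] _]; rewrite lee_fin ltW// wt_gt0. Qed.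

Let comb_sigma_additive : semi_sigma_additive comb_fun.
Proof.
move=> F mF tF mUF.
have -> : comb_fun (\bigcup_n F n) =
    (\sum_(0 <= n <oo) comb_fun (F n))%E.
  rewrite /comb_fun setI_bigcupr esum_bigcup.
  - rewrite nneseries_esum; last by move=> n _; exact: comb_ge0.
    by congr esum; apply/seteqP; split.
  - apply: sub_trivIset (trivIset_setIl tF); exact: subsetT.
  - by move=> x [n _ [[Px _] _]]; rewrite lee_fin ltW// wt_gt0.
by apply: is_cvg_ereal_nneg_natsum => n _; exact: comb_ge0.
Qed.

HB.instance Definition _ := isMeasure.Build _ _ _ comb_fun
  comb0 comb_ge0 comb_sigma_additive.

Let comb_compact (K : set G) : compact K -> (comb_fun K < +oo)%E.
Proof.
move=> cK; rewrite /comb_fun esum_fset.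
- rewrite fsbig_finite/=; last first.
    by rewrite setIAC; apply: finite_setIl; exact: finite_pts.
  by apply: lte_sum_pinfty => x _; rewrite ltry.
- by rewrite setIAC; apply: finite_setIl; exact: finite_pts.
- by move=> x; rewrite inE => -[[Px _] _]; rewrite lee_fin ltW// wt_gt0.
Qed.

(* The restriction to S of the Dirac comb of L, see [comb_onE] below; S need
   not be measurable. *)
Definition comb_on : radon R G := Radon comb_compact.

End Comb.

Definition comb (R : realType) (G : topGroupType) (L : wdelone R G) :
  radon R G := comb_on L setT.

Lemma comb_onE (R : realType) (G : topGroupType) (L : wdelone R G)
    (S A : set G) : comb_on L S A = comb L (A `&` S).
Proof. by rewrite /= /comb_fun setIT -setIA (setIC S). Qed.

Section Action.
Variables (R : realType) (G : topGroupType) (g : G) (L : wdelone R G).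

Let act_delone : delone (ltrans g (pts L)).
Proof.
have [[U [oU U0 cU U1]] [K cK PK]] := pts_delone L; split.
  exists U; split => // h x y; rewrite !ltransE/= => -[hx gx] [hy gy].
  have := U1 (g^-1 * h)%g (g^-1 * x)%g (g^-1 * y)%g.
  rewrite !ltransE/= !invgM !invgK -!mulgA !mulVKg => H.
  by apply: (@mulgI _ g^-1%g); apply: H.
exists K => //; apply/seteqP; split => // x _.
have : mulset (pts L) K (g^-1 * x)%g by rewrite PK.
case=> p Pp [k Kk] e; exists (g * p)%g; first by exists p.
by exists k => //; rewrite -mulgA e mulVKg.
Qed.

Let act_bounded : exists2 s : R, 1 <= s &
  forall x, ltrans g (pts L) x -> s^-1 <= wt L (g^-1 * x)%g <= s.
Proof.
by have [s s1 sL] := wt_bounded L; exists s => // x; rewrite ltransE => /sL.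
Qed.

Definition act : wdelone R G := WDelone act_delone act_bounded.

End Action.

Definition hull (R : realType) (G : topGroupType) (L : wdelone R G) :
  set (radon R G) := closure (range (fun g => comb (act g L))).

Definition mball (R : realType) (G : topGroupType) (d : G -> G -> R) (y : G)
  (r : R) : set G := [set x | d y x < r].

Record continuous_adapted_metric (R : realType) (G : topGroupType)
    (d : G -> G -> R) : Prop := {
  metric_eq0 : forall x y, d x y = 0 <-> x = y;
  metric_sym : forall x y, d x y = d y x;
  metric_triangle : forall x y z, d x z <= d x y + d y z;
  metric_left_invariant : forall g x y, d (g * x)%g (g * y)%g = d x y;
  metric_proper : forall y r, precompact (mball d y r);
  metric_locally_bounded : forall x : G, exists2 V : set G, nbhs x V &
    exists M : R, forall y z, V y -> V z -> d y z <= M;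
  metric_continuous : continuous (fun p : G * G => d p.1 p.2) }.

Section Patches.
Variables (R : realType) (G : topGroupType) (d : G -> G -> R).
Implicit Types (mu nu : radon R G) (S T : set G) (L : wdelone R G).

Definition supp mu : set G :=
  [set x | forall U : set G, open_nbhs x U -> (0 < mu U)%E].

Definition dist_on S mu nu : \bar R :=
  ereal_inf [set r%:E | r in [set r : R | 0 < r /\
    forall y, (S `&` (supp mu `|` supp nu)) y ->
      (`|mu (mball d y r) - nu (mball d y r)| < r%:E)%E]].

Definition patch := (radon R G * set G)%type.

Definition patch_of L S : patch := (comb_on L S, S).

Definition patch_trans (g : G) (p : patch) : patch :=
  (push p.1 g, ltrans g p.2).

Definition pattern_of (p : patch) : set patch :=
  range (fun g => patch_trans g p).

(* the patterns of L of size S: classes of the patches of L on translates of S *)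
Definition patterns L S : set (set patch) :=
  range (fun h => pattern_of (patch_of L (ltrans h S))).

Definition patch_occurs L (e : R) (p : patch) T := exists2 g,
  ltrans g p.2 `<=` T &
  (dist_on (ltrans g p.2) (push p.1 g) (comb_on L (ltrans g p.2)) < e%:E)%E.

Definition pattern_occurs L (e : R) (Q : set patch) T :=
  exists2 p, Q p & patch_occurs L e p T.

End Patches.

Section Haar.
Variables (R : realType) (G : topGroupType) (m : radon R G).

Definition haar := m [set: G] != 0%E /\
  forall g (A : set (borel G)), measurable A -> m (ltrans g A) = m A.

Definition unimodular_haar :=
  forall g (A : set (borel G)), measurable A -> m (rtrans A g) = m A.

(* [m] is only meaningful on Borel sets, and [vol] is only applied to
   relatively compact ones, where [m] is finite. *)
Definition vol (A : set G) : R := fine (m A).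

Definition boundary (L S : set G) : set G :=
  [set g | (rtrans L g `&` S) !=set0 /\ (rtrans L g `&` ~` S) !=set0].

Record strong_folner_exhaustion (T : nat -> set G) : Prop := {
  folner_compact : forall n, compact (T n);
  folner_pos : forall n, (0 < m (T n))%E;
  folner_inv : forall K, compact K -> K !=set0 ->
    vol (T n `+` mulset K (T n)) / vol (T n) @[n --> \oo] --> (0 : R);
  folner_boundary : forall K, compact K ->
    vol (boundary K (T n)) / vol (T n) @[n --> \oo] --> (0 : R);
  folner_one : forall n, T n 1%g;
  folner_incr : forall n, T n `<=` (T n.+1)°;
  folner_exhaust : \bigcup_n T n = [set: G] }.

End Haar.

Definition bounded_continuous (R : realType) (G : topGroupType) (f : G -> R) :=
  continuous f /\ exists M, forall x, `|f x| <= M.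

(* [I] is a left-invariant mean on the space of bounded continuous functions;
   its values on other functions are irrelevant. *)
Definition amenable (R : realType) (G : topGroupType) :=
  exists I : (G -> R) -> R,
  [/\ forall (a : R) f h, bounded_continuous f -> bounded_continuous h ->
        I (fun x => a * f x + h x) = a * I f + I h,
      forall f, bounded_continuous f -> (forall x, 0 <= f x) -> 0 <= I f,
      I (fun=> 1) = 1 &
      forall g f, bounded_continuous f -> I (fun x => f (g^-1 * x)%g) = I f].

(* [None] stands for infinity *)
Definition nat_inf (P : nat -> Prop) : option nat :=
  if pselect (exists n, `[< P n >]) is left h then Some (ex_minn h) else None.

Section Repetitivity.
Variables (R : realType) (G : topGroupType) (d : G -> G -> R) (m : radon R G)
  (T : nat -> set G) (L : wdelone R G).

Definition repetitivity (e : R) (k : nat) : option nat :=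
  nat_inf (fun n => forall Q, patterns L (invset (T k)°) Q ->
    forall h, pattern_occurs d L e Q (ltrans h (invset (T n)°))).

Definition zeta (e : R) : R :=
  if `[< exists k, repetitivity e k = None >] then 0
  else inf [set r | exists k n,
    repetitivity e k = Some n /\ r = vol m (T k) / vol m (T n)].

Definition almost_tempered_repetitive :=
  forall e : R, 0 < e < 1 -> 0 < zeta e.

End Repetitivity.

(* Main.v *)
Require Import Defs.
From HB Require Import structures.
From mathcomp Require Import all_boot all_order all_algebra.
From mathcomp Require Import all_classical all_reals all_analysis.
From mathcomp Require Import measurable_realfun lra.

Set Implicit Arguments.
Unset Strict Implicit.
Unset Printing Implicit Defensive.
Import Order.TTheory GRing.Theory Num.Theory.
Import numFieldNormedType.Exports.
Local Open Scope classical_set_scope.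
Local Open Scope ring_scope.

(** Write mu for the Dirac comb of Lambda, v_n for the Haar volume of T_n, and
    N_n(h) for the mass mu(h T_n^-1). Since delta_(g Lambda)(T_n^-1) is
    N_n(g^-1), the theorem concerns the numbers N_n(h)/v_n, uniformly in h.

    The only tool for comparing scales is an averaging inequality
    ([averaging], [density_bound]): if N_j(h) <= c v_j for all h, and A T_j is
    contained in W, then mu(A) <= c m(W). It is Tonelli applied to the pairs
    (x, h) with x in A and h in x T_j: the sections in h have volume v_j by
    left invariance, and the sections in x have mass at most N_j(h).

    Let b be the infimum over n of sup_h N_n(h)/v_n. Averaging with
    A = h T_n^-1 and a scale j almost attaining the infimum bounds mu(A) by
    about b m(T_n^-1 T_j), that is, b m(T_j^-1 T_n), since a unimodular Haar
    measure is invariant under inversion ([haar_invset]). The Folner property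
    makes this b v_n up to a factor close to 1, so b is a uniform upper
    density at every large scale ([density_le]).

    Repetitivity gives the lower half ([repetitive_density_ge]). Suppose that
    some window h0 T_k^-1 had mass well below b v_k. Put n = max(R(delta,k), k)
    and choose h with N_n(h) at least nearly b v_n. The window h T_n^-1
    contains a delta-copy S of the poor patch. By uniform discreteness
    a delta-copy has almost the same mass ([occurrence_mass]), and the rest of
    the window has density at most about b, by averaging again
    ([density_outside_patch]). Since v_k/v_n is bounded below by zeta(delta),
    the deficit of S is a fixed proportion of v_n and contradicts the choice
    of h.

    Elements of the hull are only weak-* limits of translates, so they are
    compared with the translates through continuous bump functions. These
    force a passage from T_n^-1 to T_n^-1 T_1 from above ([hull_vol_le]) and to
    an erosion of T_n from below ([hull_vol_ge]). Both changes are negligible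
    by the Folner and boundary conditions ([density_le],
    [density_erosion_ge]). *)

(** * Products, inverses and translates of sets *)

Section SetAlgebra.
Variable G : topGroupType.
Implicit Types (A B C S : set G) (g x : G).

Lemma rtransE A g : rtrans A g = [set x | A (x * g^-1)%g].
Proof.
apply/seteqP; split=> [_ [a Aa <-]/=|x /= Ax]; first by rewrite mulgK.
by exists (x * g^-1)%g => //; rewrite mulgVK.
Qed.

Lemma invsetE A : invset A = [set x | A (x^-1)%g].
Proof.
apply/seteqP; split=> [_ [a Aa <-]/=|x /= Ax]; first by rewrite invgK.
by exists (x^-1)%g => //; rewrite invgK.
Qed.

Lemma invsetK A : invset (invset A) = A.
Proof. by apply/seteqP; split=> x; rewrite !invsetE/= invgK. Qed.

Lemma invset_mulset A B : invset (mulset A B) = mulset (invset B) (invset A).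
Proof.
apply/seteqP; split=> x.
  by case=> _ [a Aa [b Bb <-]] <-; exists (b^-1)%g; [exists b|exists (a^-1)%g;
    [exists a|rewrite invgM]].
case=> _ [b Bb <-] [_ [a Aa <-]] <-; exists (a * b)%g; last by rewrite invgM.
by exists a => //; exists b.
Qed.

Lemma mulset_ltrans g A B : mulset (ltrans g A) B = ltrans g (mulset A B).
Proof.
apply/seteqP; split=> x.
  case=> _ [a Aa <-] [b Bb <-]; exists (a * b)%g; last by rewrite mulgA.
  by exists a => //; exists b.
case=> _ [a Aa [b Bb <-]] <-; exists (g * a)%g; first by exists a.
by exists b => //; rewrite mulgA.
Qed.

Lemma mulsetA A B C : mulset A (mulset B C) = mulset (mulset A B) C.
Proof.
apply/seteqP; split=> x.
  case=> a Aa [_ [b Bb [c Cc <-]] <-]; exists (a * b)%g; first by exists a => //; exists b.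
  by exists c => //; rewrite mulgA.
case=> _ [a Aa [b Bb <-]] [c Cc <-]; exists a => //; exists (b * c)%g.
  by exists b => //; exists c.
by rewrite mulgA.
Qed.

Lemma ltrans_sub g A B : A `<=` B -> ltrans g A `<=` ltrans g B.
Proof. by move=> AB _ [a Aa <-]; exists a => //; exact: AB. Qed.

Lemma invset_sub A B : A `<=` B -> invset A `<=` invset B.
Proof. by move=> AB _ [a Aa <-]; exists a => //; exact: AB. Qed.

Lemma sub_mulset_one A B : B 1%g -> A `<=` mulset A B.
Proof. by move=> B1 a Aa; exists a => //; exists 1%g => //; rewrite mulg1. Qed.

Lemma compact_mulset A B : compact A -> compact B -> compact (mulset A B).
Proof.
move=> cA cB; rewrite (_ : mulset A B = (fun p : G * G => (p.1 * p.2)%g) @` (A `*` B)).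
  apply: continuous_compact; last exact: compact_setX.
  by apply: continuous_subspaceT => x; exact: mulg_continuous.
apply/seteqP; split=> [_ [a Aa [b Bb <-]]|_ [[a b] [/= Aa Bb] <-]].
  by exists (a, b).
by exists a => //; exists b.
Qed.

Lemma compact_invset A : compact A -> compact (invset A).
Proof.
move=> cA; apply: continuous_compact => //.
by apply: continuous_subspaceT => x; exact: invg_continuous.
Qed.

Lemma rmul_continuous g : continuous (fun x : G => (x * g)%g).
Proof.
move=> x; apply: (@continuous_comp _ _ _ (fun x : G => (x, g))
  (fun p : G * G => (p.1 * p.2)%g)); last exact: mulg_continuous.
by apply: cvg_pair => //=; exact: cvg_cst.
Qed.

Lemma open_invset A : open A -> open (invset A).
Proof.
rewrite invsetE => oA; apply: (@open_comp _ _ (fun x : G => (x^-1)%g)) => //.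
by move=> x _; exact: invg_continuous.
Qed.

Lemma open_mulset A B : open B -> open (mulset A B).
Proof.
move=> oB; rewrite (_ : mulset A B = \bigcup_(a in A) ltrans a B).
  by apply: bigcup_open => a _; exact: open_ltrans.
apply/seteqP; split=> [_ [a Aa [b Bb <-]]|_ [a Aa [b Bb <-]]].
  by exists a => //; exists b.
by exists a => //; exists b.
Qed.

End SetAlgebra.

(** * Borel sets of a topological group *)

Section BorelSets.
Variable G : topGroupType.
Implicit Types (A B : set G).

Lemma open_borel A : open A -> measurable (A : set (borel G)).
Proof. exact: sub_sigma_algebra. Qed.

Lemma closed_borel A : closed A -> measurable (A : set (borel G)).
Proof.
move=> cA; rewrite -[A]setCK; apply: measurableC; apply: open_borel.
exact: closed_openC.
Qed.

Lemma compact_borel A : hausdorff_space G -> compact A ->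
  measurable (A : set (borel G)).
Proof. by move=> hG cA; apply: closed_borel; exact: compact_closed. Qed.

Lemma continuous_borel (f : G -> G) : continuous f ->
  measurable_fun [set: borel G] (f : borel G -> borel G).
Proof.
move=> cf; apply: (@measurability _ _ (borel G) (borel G) _ _ (@open G)) => //.
move=> _ [B oB <-]; rewrite setTI; apply: open_borel.
by apply: open_comp => // x _; exact: cf.
Qed.

Lemma preimage_borel (f : G -> G) A : continuous f ->
  measurable (A : set (borel G)) -> measurable (f @^-1` A : set (borel G)).
Proof.
by move=> cf mA; rewrite -[X in measurable X]setTI; exact: (continuous_borel cf).
Qed.

Lemma invset_borel A : measurable (A : set (borel G)) ->
  measurable (invset A : set (borel G)).
Proof. by rewrite invsetE; apply: preimage_borel; exact: invg_continuous. Qed.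

Lemma ltrans_borel g A : measurable (A : set (borel G)) ->
  measurable (ltrans g A : set (borel G)).
Proof. by rewrite ltransE; apply: preimage_borel; exact: lmul_continuous. Qed.

(** Second countability puts the open sets of G x G in the product of the two
    Borel sigma-algebras: an open set is a countable union of rectangles with
    sides in a countable basis. Without it, the group operations need not be
    jointly measurable and Tonelli would not apply to them. *)
Lemma continuous2_borel (f : G * G -> G) : @second_countable G ->
  continuous f ->
  measurable_fun [set: borel G * borel G] (f : borel G * borel G -> borel G).
Proof.
move=> [B cB [oB bB]] cf.
apply: (@measurability _ _ (borel G * borel G)%type (borel G) _ _ (@open G)) => //.
move=> _ [U oU <-]; rewrite setTI.
have oW : open (f @^-1` U) by apply: open_comp => // x _; exact: cf.
pose I := [set p : set G * set G | [/\ B p.1, B p.2 & p.1 `*` p.2 `<=` f @^-1` U]].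
rewrite (_ : f @^-1` U = \bigcup_(p in I) (p.1 `*` p.2)).
  have [e injB] := countable_injP _ cB.
  (* The code (e U, e V) of a rectangle turns the union into one over nat. *)
  pose F n := \bigcup_(p in I `&` [set p | pickle (e p.1, e p.2) = n]) (p.1 `*` p.2).
  rewrite (_ : bigcup _ _ = \bigcup_n F n); last first.
    apply/seteqP; split=> x; last by move=> [n _ [p [Ip _] px]]; exists p.
    by move=> [p Ip px]; exists (pickle (e p.1, e p.2)) => //; exists p.
  apply: bigcupT_measurable => n; rewrite /F.
  have [[p [[Bp1 Bp2 pU] pn]]|nI] :=
      pselect (exists p, (I `&` [set p | pickle (e p.1, e p.2) = n]) p).
    rewrite (_ : _ `&` _ = [set p]) ?bigcup_set1.
      by apply: measurableX; apply: open_borel; exact: oB.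
    apply/seteqP; split=> [q [[Bq1 Bq2 _] qn]|_ ->]; last by [].
    have : (e q.1, e q.2) = (e p.1, e p.2) by apply: (pcan_inj pickleK); rewrite qn pn.
    case=> /injB q1 /injB q2; rewrite /= [q]surjective_pairing [p]surjective_pairing.
    by rewrite q1 ?inE// q2 ?inE.
  rewrite (_ : _ `&` _ = set0) ?bigcup_set0//; apply/seteqP; split=> // p Ip.
  by apply: nI; exists p.
apply/seteqP; split; last by move=> x [p [_ _ pU] /pU].
move=> [x y] Uxy.
have [[P Q] /= [/bB[P' [BP' P'x] P'P] /bB[Q' [BQ' Q'y] Q'Q]] PQU] :
  nbhs (x, y) (f @^-1` U) by exact: open_nbhs_nbhs.
exists (P', Q') => //; split => // -[u v] [/= /P'P Pu /Q'Q Qv].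
by apply: PQU.
Qed.

End BorelSets.

(** * Tonelli, averaging and inversion invariance *)

Section Tonelli.
Variables (R : realType) (G : topGroupType).
Implicit Types (mu nu : radon R G) (A B D W : set G).

Lemma tonelli_sigma_finite d1 d2 (X : measurableType d1) (Y : measurableType d2)
    (mu : {measure set X -> \bar R}) (nu : {measure set Y -> \bar R})
    (E : set (X * Y)) :
  sigma_finite [set: X] mu -> sigma_finite [set: Y] nu -> measurable E ->
  (\int[mu]_x nu (xsection E x) = \int[nu]_y mu (ysection E y))%E /\
  measurable_fun [set: Y] (mu \o ysection E).
Proof.
move=> smu snu mE.
pose H1 := isSFinite.Build _ _ _ _ (sfinite_measure_sigma_finite smu).
pose H2 := isSigmaFinite.Build _ _ _ _ smu.
pose mu1 := HB.pack_for (SigmaFiniteMeasure.type X R) (Measure.sort mu) H1 H2.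
pose H3 := isSFinite.Build _ _ _ _ (sfinite_measure_sigma_finite snu).
pose H4 := isSigmaFinite.Build _ _ _ _ snu.
pose nu1 := HB.pack_for (SigmaFiniteMeasure.type Y R) (Measure.sort nu) H3 H4.
have -> : mu = mu1 by exact: eq_measure.
have -> : nu = nu1 by exact: eq_measure.
split; last exact: (@measurable_fun_ysection _ _ _ _ R mu1 E mE).
have := @indic_fubini_tonelli _ _ X Y R mu1 nu1 E mE.
by rewrite indic_fubini_tonelli_FE// indic_fubini_tonelli_GE.
Qed.

Lemma tonelli_sections mu nu (K : nat -> set G) (E : set (borel G * borel G)) :
  hausdorff_space G -> (forall n, compact (K n)) -> \bigcup_n K n = [set: G] ->
  measurable E ->
  (\int[mu]_x nu (xsection E x) = \int[nu]_y mu (ysection E y))%E /\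
  measurable_fun [set: borel G] (mu \o ysection E).
Proof.
move=> hG cK KT; have sf (m : radon R G) : sigma_finite [set: borel G] m.
  exists K => //; move=> n; split; first exact: compact_borel.
  exact: radon_compact.
exact: tonelli_sigma_finite.
Qed.

Lemma preimage2_borel (f : G * G -> G) A : @second_countable G ->
  continuous f -> measurable (A : set (borel G)) ->
  measurable (f @^-1` A : set (borel G * borel G)).
Proof.
move=> sG cf mA; rewrite -[X in measurable X]setTI.
exact: (continuous2_borel sG cf).
Qed.

Lemma integral_const_on mu A (c : \bar R) (f : G -> \bar R) :
  measurable (A : set (borel G)) -> (0 <= c)%E ->
  (forall x, A x -> f x = c) -> (forall x, ~ A x -> f x = 0%E) ->
  (\int[mu]_x f x = c * mu A)%E.
Proof.
move=> mA c0 fA fN.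
rewrite -(integral_cst mu mA) [RHS]integral_mkcond; apply: eq_integral => x _.
rewrite patchE; case: ifPn; first by rewrite inE => /fA.
by rewrite notin_setE => /fN.
Qed.

End Tonelli.

Section Averaging.
Variables (R : realType) (G : topGroupType).
Hypotheses (hG : hausdorff_space G) (sG : @second_countable G).
Variable K : nat -> set G.
Hypotheses (cK : forall n, compact (K n)) (KT : \bigcup_n K n = [set: G]).
Implicit Types (mu : radon R G) (A B D W : set G).
Variable m : radon R G.
Hypothesis linv : forall g (A : set (borel G)), measurable A -> m (ltrans g A) = m A.

Let cdivl : continuous (fun p : G * G => (p.1^-1 * p.2)%g).
Proof.
move=> p; apply: (@continuous_comp _ _ _ (fun p : G * G => ((p.1)^-1%g, p.2))
  (fun p : G * G => (p.1 * p.2)%g)); last exact: mulg_continuous.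
apply: cvg_pair => //=; last exact: cvg_snd.
by apply: (@continuous_comp _ _ _ fst (fun x : G => x^-1%g));
  [exact: cvg_fst|exact: invg_continuous].
Qed.

Let cmul : continuous (fun p : G * G => (p.1 * p.2)%g).
Proof. exact: mulg_continuous. Qed.

(** Double counting of the pairs (x, h) with x in A and h in x D: the fibre
    over x has volume m D by left invariance, while the fibre over h lies in
    h D^-1 and is empty unless h belongs to A D. *)
Lemma averaging mu A D W (c : \bar R) :
  measurable (A : set (borel G)) -> measurable (D : set (borel G)) ->
  measurable (W : set (borel G)) -> mulset A D `<=` W ->
  (forall h, mu (ltrans h (invset D)) <= c)%E ->
  (m D * mu A <= c * m W)%E.
Proof.
move=> mA mD mW ADW muc.
have c0 : (0 <= c)%E by rewrite (le_trans _ (muc 1%g)).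
pose E : set (borel G * borel G) :=
  (fst @^-1` A) `&` ((fun p => (p.1^-1 * p.2)%g) @^-1` D).
have mE : measurable E.
  apply: measurableI; last exact: (preimage2_borel sG cdivl mD).
  by rewrite -[X in measurable X]setTI; exact: measurable_fst.
have [EE mEE] := tonelli_sections mu m hG cK KT mE.
have -> : (m D * mu A = \int[mu]_x m (xsection E x))%E.
  symmetry; apply: integral_const_on => // x.
    move=> Ax; rewrite -(linv x mD) ltransE; congr (m _).
    by apply/seteqP; split=> y; rewrite /xsection /= inE /E /=; [case|split].
  move=> nAx; rewrite (_ : xsection _ _ = set0) ?measure0//.
  by apply/seteqP; split=> y //; rewrite /xsection /= inE /E /= => -[].
rewrite EE -integral_cst// [leRHS]integral_mkcond.
apply: ge0_le_integral => //=.
- exact: (measurable_restrictT (cst c) mW).1 (@measurable_cst _ _ _ _ _ c).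
- move=> h _; rewrite patchE; case: ifPn => [_|].
    apply: le_trans (muc h); apply: le_measure; rewrite ?inE.
    + exact: measurable_ysection.
    + by apply: ltrans_borel; exact: invset_borel.
    + move=> x; rewrite /ysection /= inE /E /= ltransE invsetE /= => -[_].
      by rewrite invgM invgK.
  rewrite notin_setE => nWh; rewrite (_ : ysection _ _ = set0) ?measure0//.
  apply/seteqP; split=> x //; rewrite /ysection /= inE /E /= => -[Ax Dx].
  by apply/nWh/ADW; exists x => //; exists (x^-1 * h)%g => //; rewrite mulVKg.
Qed.

Hypothesis rinv : forall g (A : set (borel G)), measurable A -> m (rtrans A g) = m A.

(** The intersection of y A and B has the same volume as that of A and y^-1 B.
    Integrating either volume over y with Tonelli gives m(A^-1) m(B) for the
    first, by left invariance, and m(B) m(A) for the second, by right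
    invariance. *)
Lemma haar_invset_mul A B : measurable (A : set (borel G)) ->
  measurable (B : set (borel G)) -> (m (invset A) * m B = m B * m A)%E.
Proof.
move=> mA mB.
pose E1 : set (borel G * borel G) :=
  ((fun p => (p.1^-1 * p.2)%g) @^-1` A) `&` (snd @^-1` B).
pose E2 : set (borel G * borel G) :=
  (snd @^-1` A) `&` ((fun p => (p.1 * p.2)%g) @^-1` B).
have mE1 : measurable E1.
  apply: measurableI; first exact: (preimage2_borel sG cdivl mA).
  by rewrite -[X in measurable X]setTI; exact: measurable_snd.
have mE2 : measurable E2.
  apply: measurableI; last exact: (preimage2_borel sG cmul mB).
  by rewrite -[X in measurable X]setTI; exact: measurable_snd.
have [EE1 _] := tonelli_sections m m hG cK KT mE1.
have [EE2 _] := tonelli_sections m m hG cK KT mE2.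
have <- : (\int[m]_x m (ysection E1 x) = m (invset A) * m B)%E.
  apply: integral_const_on => // x.
    move=> Bx; rewrite -(linv x (invset_borel mA)); congr (m _).
    rewrite ltransE invsetE; apply/seteqP; split=> y;
      rewrite /ysection /= inE /E1 /= invgM invgK; by [case|split].
  move=> nBx; rewrite (_ : ysection _ _ = set0) ?measure0//.
  by apply/seteqP; split=> y //; rewrite /ysection /= inE /E1 /= => -[].
have <- : (\int[m]_x m (ysection E2 x) = m B * m A)%E.
  apply: integral_const_on => // x.
    move=> Ax; rewrite -(rinv x^-1%g mB); congr (m _).
    rewrite rtransE invgK; apply/seteqP; split=> y;
      rewrite /ysection /= inE /E2 /=; by [case|split].
  move=> nAx; rewrite (_ : ysection _ _ = set0) ?measure0//.
  by apply/seteqP; split=> y //; rewrite /ysection /= inE /E2 /= => -[].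
rewrite -EE1 -EE2; apply: eq_integral => y _.
rewrite -[RHS](linv y); last exact: measurable_xsection.
congr (m _); rewrite ltransE; apply/seteqP; split=> x;
  rewrite /xsection /= !inE /E1 /E2 /= mulVKg; by case.
Qed.

Lemma haar_invset A B : measurable (A : set (borel G)) -> compact B ->
  (0 < m B)%E -> m (invset A) = m A.
Proof.
move=> mA cB B0; have mB := compact_borel hG cB.
have Bfin : m B \is a fin_num by rewrite ge0_fin_numE// radon_compact.
have := haar_invset_mul mA mB; rewrite [RHS]muleC.
move=> H; apply/eqP; rewrite eq_le.
by rewrite -(lee_pmul2r Bfin B0) -[X in _ && X](lee_pmul2r Bfin B0) H lexx.
Qed.

End Averaging.

(** * Adapted metrics and small balls *)

Section MetricBalls.
Variables (R : realType) (G : topGroupType) (d : G -> G -> R).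
Hypothesis Hd : continuous_adapted_metric d.

Lemma adapted_metric_ge0 x y : 0 <= d x y.
Proof.
have := Defs.metric_triangle Hd x y x.
rewrite (Defs.metric_sym Hd y x) (Defs.metric_eq0 Hd x x).2//; lra.
Qed.

Lemma continuous_dist x : continuous (d x).
Proof.
move=> y; apply: (@continuous_comp _ _ _ (fun z : G => (x, z))
  (fun p : G * G => d p.1 p.2)); last exact: Defs.metric_continuous Hd _.
by apply: cvg_pair => //=; exact: cvg_cst.
Qed.

Lemma open_mball y r : open (mball d y r).
Proof.
apply: (@open_comp _ _ (d y) [set x | x < r]) => [x _|]; last exact: open_lt.
exact: continuous_dist.
Qed.

(** The metric is only assumed continuous, so its topology could a priori be
    coarser. Properness rules this out: on the compact part of a unit ball
    outside U the distance to x is positive, hence bounded away from 0. *)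
Lemma mball_nbhs x (U : set G) : nbhs x U ->
  exists2 r, 0 < r & mball d x r `<=` U.
Proof.
move=> xU; set B := closure (mball d x 1).
have cB : compact B by rewrite -precompactE; exact: Defs.metric_proper Hd x 1.
have cC : compact (B `&` ~` U°).
  by apply: compact_closedI => //; apply: open_closedC; exact: open_interior.
have := (compact_near_coveringP _).1 cC R (0^'+) (fun r y => r <= d x y) _.
case=> [y [_ nUy]|e /= e0 He].
  have xy0 : 0 < d x y.
    rewrite lt_neqAle adapted_metric_ge0 andbT eq_sym; apply/eqP => /(Defs.metric_eq0 Hd) xy.
    by apply: nUy; rewrite -xy.
  exists ([set z | d x y / 2 < d x z], [set r | r <= d x y / 2]) => /=.
    split.
      apply: open_nbhs_nbhs; split; last by rewrite /=; lra.
      apply: (@open_comp _ _ (d x) [set t | d x y / 2 < t]); last exact: open_gt.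
      by move=> z _; exact: continuous_dist.
    by apply: nbhs_right_le; lra.
  by move=> [z r] [/= zr] /le_trans; apply; exact: ltW.
exists (Num.min 1 (e / 2)) => [|z].
  by rewrite lt_min ltr01 divr_gt0.
rewrite /mball /= lt_min => /andP[z1 ze]; apply: contrapT => nUz.
have : (ball_ Num.norm 0 e) (e / 2) by rewrite /= sub0r normrN gtr0_norm; lra.
move=> /He /(_ _ z) H; have {}H : e / 2 <= d x z.
  by apply: H; [lra|split; [exact: subset_closure|move=> /interior_subset]].
by have := le_lt_trans H ze; rewrite ltxx.
Qed.

End MetricBalls.

(** * Dirac combs of weighted Delone sets *)

Section Combs.
Variables (R : realType) (G : topGroupType) (L : wdelone R G).

Lemma le_comb (A B : set G) : A `<=` B -> (comb L A <= comb L B)%E.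
Proof.
move=> AB; rewrite /comb /= /comb_fun !setIT !esum_mkcondr.
apply: le_esum => x Px; case: ifPn => [|_].
  by rewrite inE => /AB Bx; rewrite ifT// inE.
by case: ifPn => // _; rewrite lee_fin ltW// wt_gt0.
Qed.

Lemma comb_pts0 (A : set G) : pts L `&` A = set0 -> comb L A = 0%E.
Proof. by rewrite /comb /= /comb_fun setIT => ->; rewrite esum_set0. Qed.

Lemma comb_pts1 (A : set G) x : pts L `&` A = [set x] ->
  comb L A = (wt L x)%:E.
Proof.
move=> Ax; have [Px _] : (pts L `&` A) x by rewrite Ax.
rewrite /comb /= /comb_fun setIT Ax esum_set1// lee_fin.
exact/ltW/wt_gt0.
Qed.

(** Cover K by finitely many translates of the open set U of the Delone
    condition. Their number does not change under translation, and each of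
    them carries at most one point, of weight at most s. *)
Lemma comb_translation_bounded (K : set G) : compact K ->
  exists M : R, forall h, (comb L (ltrans h K) <= M%:E)%E.
Proof.
rewrite compact_cover => cK; have [[U [oU [u0 Uu0] _ U1]] _] := pts_delone L.
have [s s1 sL] := wt_bounded L.
have [|x Kx|D _ KD] := cK G setT (fun g => ltrans g U).
- by move=> g _; exact: open_ltrans.
- by exists (x * u0^-1)%g => //; exists u0 => //; rewrite mulgVK.
have UM g : (comb L (ltrans g U) <= s%:E)%E.
  have [[x Ax]|nA] := pselect (exists x, (pts L `&` ltrans g U) x).
    rewrite (@comb_pts1 _ x) ?lee_fin; first by have /andP[] := sL x Ax.1.
    apply/seteqP; split=> [y Ay|_ ->//].
    by apply: (U1 g); rewrite setIC.
  rewrite comb_pts0 ?lee_fin; first exact: le_trans s1.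
  by apply/seteqP; split=> // x Ax; apply: nA; exists x.
pose V (l : seq G) := \bigcup_(g in [set` l]) ltrans g U.
have oV l : open (V l) by apply: bigcup_open => g _; exact: open_ltrans.
have VM l : exists M : R, forall h, (comb L (ltrans h (V l)) <= M%:E)%E.
  elim: l => [|g l [M HM]].
    exists 0 => h; rewrite comb_pts0//; apply/seteqP; split=> // x [_ [y [g]]].
    by [].
  exists (s + M) => h; rewrite EFinD.
  apply: le_trans (leeD (UM (h * g)%g) (HM h)).
  have -> : ltrans h (V (g :: l)) = ltrans (h * g)%g U `|` ltrans h (V l).
    rewrite -ltransM !(ltransE h) /V; apply/seteqP; split=> x /=.
      by case=> k /=; rewrite inE => /orP[/eqP->|kl]; [left|right; exists k].
    case=> [gx|[k kl kx]]; first by exists g => //=; rewrite mem_head.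
    by exists k => //=; rewrite inE; apply/orP; right.
  by apply: measureU2; apply: open_borel; exact: open_ltrans.
have [M HM] := VM (finmap.enum_fset D).
by exists M => h; apply: le_trans (HM h); apply: le_comb; exact: ltrans_sub.
Qed.

Lemma pts_uniformly_discrete (d : G -> G -> R) : continuous_adapted_metric d ->
  exists2 r, 0 < r & forall y x1 x2, pts L x1 -> pts L x2 ->
    d y x1 < r -> d y x2 < r -> x1 = x2.
Proof.
move=> Hd; have [[U [oU [u0 Uu0] _ U1]] _] := pts_delone L.
have : nbhs u0 U by exact: open_nbhs_nbhs.
move=> /(mball_nbhs Hd)[r r0 rU]; exists r => // y x1 x2 P1 P2 yx1 yx2.
have H x : d y x < r -> ltrans (y * u0^-1)%g U x.
  move=> yx; rewrite ltransE; apply: rU.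
  rewrite /mball /= -(Defs.metric_left_invariant Hd (y * u0^-1)%g).
  by rewrite mulgVK mulVKg.
by apply: (U1 (y * u0^-1)%g); split=> //; exact: H.
Qed.

(** Below the discreteness radius a ball contains at most one point of Lambda,
    so closeness of the two measures on balls sends each point y of Lambda in
    g X to a point phi y of Lambda in X whose weight is at least
    wt y - e >= (1 - e s) wt y. The point phi y exists because an empty ball
    would force wt y < e < 1/s, and phi is injective by discreteness again. *)
Lemma occurrence_mass (d : G -> G -> R) : continuous_adapted_metric d ->
  exists r0 s : R, [/\ 0 < r0, 1 <= s & forall (e : R) (g : G) (X : set G)
      (mu : radon R G), 0 < e < r0 -> e * s < 1 ->
    finite_set (pts L `&` ltrans g X) ->
    (forall A, mu A = comb L ((fun x => (g * x)%g) @^-1` A `&` X)) ->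
    (dist_on d (ltrans g X) mu (comb_on L (ltrans g X)) < e%:E)%E ->
    ((1 - e * s)%:E * comb L (ltrans g X) <= comb L X)%E].
Proof.
move=> Hd; have [r0 r00 discr] := pts_uniformly_discrete Hd.
have [s s1 sL] := wt_bounded L.
exists r0, s; split=> // e g X mu /andP[e0 er0] es1 finY muE.
move=> /ereal_inf_lt[_ [r /= [r_gt0 Hr] <-]]; rewrite lte_fin => re.
set Y := pts L `&` ltrans g X.
have s0 : 0 < s by exact: lt_le_trans s1.
have ws x : pts L x -> 1 <= s * wt L x.
  by move=> /sL /andP[+ _]; rewrite -[s^-1]mul1r ler_pdivrMr// mulrC.
have dr0 (y x : G) : d y x < r -> d y x < r0.
  by move=> yx; rewrite (lt_trans yx)// (lt_trans re).
have /choice [phi Hphi] : forall y, exists x, Y y ->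
    [/\ pts L x, X x, d y (g * x)%g < r & (1 - e * s) * wt L y <= wt L x].
  move=> y; have [[Py Xy]|nYy] := pselect (Y y); last by exists y.
  have nuB : comb_on L (ltrans g X) (mball d y r) = (wt L y)%:E.
    rewrite comb_onE; apply: comb_pts1; apply/seteqP; split.
      move=> z [Pz [yz _]]; apply: (discr y) => //; first exact: dr0.
      by rewrite (Defs.metric_eq0 Hd y y).2.
    by move=> _ ->; do 2 split => //; rewrite /mball /= (Defs.metric_eq0 Hd y y).2.
  have suppy : (ltrans g X `&` (supp mu `|` supp (comb_on L (ltrans g X)))) y.
    split=> //; right=> U [oU Uy]; rewrite comb_onE.
    apply: (@lt_le_trans _ _ (comb L [set y])).
      rewrite (@comb_pts1 _ y) ?lte_fin ?wt_gt0//.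
      by apply/seteqP; split=> [z []//|_ ->].
    by apply: le_comb => _ ->.
  have {}Hr := Hr y; rewrite nuB in Hr.
  have [[x [Px Xx yx]]|nx] :=
      pselect (exists x, [/\ pts L x, X x & d y (g * x)%g < r]).
    have muB : mu (mball d y r) = (wt L x)%:E.
      rewrite muE; apply: comb_pts1; apply/seteqP; split; last by move=> _ ->.
      move=> z [Pz [yz _]]; apply: (discr (g^-1 * y)%g) => //; apply: dr0.
        by rewrite -(Defs.metric_left_invariant Hd g) mulVKg.
      by rewrite -(Defs.metric_left_invariant Hd g) mulVKg.
    exists x => _; split=> //.
    have := Hr suppy; rewrite muB -EFinB abse_EFin lte_fin ltr_distlC.
    move=> /andP[_ yxr]; have := ws y Py; nra.
  have muB : mu (mball d y r) = 0%E.
    rewrite muE; apply: comb_pts0; apply/seteqP; split=> // z [Pz [yz Xz]].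
    by apply: nx; exists z.
  have := Hr suppy; rewrite muB sub0e abseN abse_EFin lte_fin.
  rewrite gtr0_norm ?wt_gt0// => wr; have := ws y Py; nra.
have injphi : set_inj Y phi.
  move=> y1 y2; rewrite !inE => Y1 Y2 y12.
  have [_ _ d1 _] := Hphi _ Y1; have [_ _ d2 _] := Hphi _ Y2.
  apply: (discr (g * phi y1)%g); [exact: Y1.1|exact: Y2.1| |]; apply: dr0.
    by rewrite (Defs.metric_sym Hd).
  by rewrite y12 (Defs.metric_sym Hd).
rewrite /comb /= /comb_fun !setIT -/Y.
have -> : ((1 - e * s)%:E * (\esum_(x in Y) (wt L x)%:E) =
    \esum_(x in Y) ((1 - e * s) * wt L x)%:E)%E.
  have w0 x : Y x -> 0 < wt L x by case=> Px _; exact: wt_gt0.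
  rewrite !esum_fset// => [||x].
  - by rewrite !fsumEFin// -EFinM mulr_fsumr.
  - by move=> x; rewrite inE => /w0 ?; rewrite lee_fin mulr_ge0// ?ltW//; lra.
  - by rewrite inE => /w0 ?; rewrite lee_fin ltW.
apply: (@le_trans _ _ (\esum_(x in Y) (wt L (phi x))%:E)%E).
  by apply: le_esum => y Yy; rewrite lee_fin; have [] := Hphi _ Yy.
rewrite -(esum_image Y phi (fun x => (wt L x)%:E))//.
rewrite -(@setIidr _ (pts L `&` X) (phi @` Y)); last first.
  by move=> _ [y Yy <-]; have [] := Hphi _ Yy.
rewrite esum_mkcondr; apply: le_esum => x [Px _]; case: ifPn => // _.
by rewrite lee_fin ltW// wt_gt0.
Qed.

End Combs.

(** * Testing the hull against bump functions *)

Section Testing.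
Variables (R : realType) (G : topGroupType).
Hypothesis hG : hausdorff_space G.

Lemma continuous_real_borel (f : G -> R) : continuous f ->
  measurable_fun [set: borel G] (f : borel G -> R).
Proof.
move=> cf; apply: (measurability _ (RGenOpens.measurableE R)) => _ [_ [a [b ->] <-]].
rewrite setTI; apply: open_borel; apply: open_comp; last exact: interval_open.
by move=> x _; exact: cf.
Qed.

(** The function max(0, 1 - dist(x, K)/r). It is Lipschitz for d, hence
    continuous, and its support lies in K times a closed ball. *)
Lemma bump_exists (d : G -> G -> R) (K : set G) (r : R) :
  continuous_adapted_metric d -> compact K -> 0 < r ->
  exists f : Cc R G, [/\ forall x, 0 <= f x <= 1, forall x, K x -> f x = 1 &
    forall x, f x != 0 -> exists2 k, K k & d k x < r].
Proof.
move=> Hd cK r0.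
(* The infimum of distances to the empty set is 0 by default, which would give
   the wrong function. *)
have [->|K0] := eqVneq K set0.
  pose z : G -> R := fun=> 0.
  have c0 : continuous z by move=> x; exact: cvg_cst.
  have s0 : compact (closure [set x | z x != 0]).
    rewrite (_ : [set x | _] = set0) ?closure0; first exact: compact0.
    by apply/seteqP; split=> // x /=; rewrite /z eqxx.
  exists (MkCc c0 s0); split=> //= x; first by rewrite lexx ler01.
  by rewrite eqxx.
have [k0 Kk0] : K !=set0 by exact/set0P.
pose D x := [set d k x | k in K].
pose del x := inf (D x).
have lbD x : has_lbound (D x) by exists 0 => _ [k _ <-]; exact: adapted_metric_ge0.
have nD x : D x !=set0 by exists (d k0 x); exists k0.
have del_le x k : K k -> del x <= d k x by move=> Kk; apply: ge_inf => //; exists k.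
have del_ge0 x : 0 <= del x by apply: lb_le_inf => // _ [k _ <-]; exact: adapted_metric_ge0.
have del_lip x y : del x <= del y + d y x.
  rewrite -lerBlDr; apply: lb_le_inf => // _ [k Kk <-].
  rewrite lerBlDr; apply: le_trans (del_le x k Kk) _.
  exact: Defs.metric_triangle Hd _ _ _.
pose f x := Num.max 0 (1 - del x / r).
have f_lip x y : f y <= f x + d x y / r.
  rewrite /f ge_max; apply/andP; split.
    apply: addr_ge0; first by rewrite le_max lexx.
    by apply: divr_ge0; [exact: adapted_metric_ge0 Hd _ _|exact: ltW].
  apply: (@le_trans _ _ (1 - del x / r + d x y / r)).
    suff : del x / r <= del y / r + d x y / r by lra.
    by rewrite -mulrDl ler_pM2r ?invr_gt0// (Defs.metric_sym Hd x).
  by rewrite lerD2r le_max lexx orbT.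
have cf : continuous f.
  move=> x; apply/cvgrPdist_lt => e e0.
  have xB : nbhs x (mball d x (e * r)).
    apply: open_nbhs_nbhs; split; first exact: open_mball.
    by rewrite /mball /= (Defs.metric_eq0 Hd x x).2// mulr_gt0.
  near=> y; have yx : d x y / r < e.
    by near: y; apply: filterS xB => y; rewrite /mball /= ltr_pdivrMr.
  rewrite ltr_distl; have := f_lip x y; have := f_lip y x.
  by rewrite (Defs.metric_sym Hd y x) => ? ?; apply/andP; split; lra.
have fnear x : f x != 0 -> exists2 k, K k & d k x < r.
  move=> fx0; have : del x < r.
    rewrite ltNge; apply: contra fx0 => rdel; rewrite /f max_l//.
    by rewrite subr_le0 ler_pdivlMr// mul1r.
  have := @inf_adherent _ (D x) (r - del x) => + rx.
  rewrite subr_gt0 => /(_ rx) [//|_ [k Kk <-]].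
  by rewrite addrC subrK => kx; exists k.
have sf : compact (closure [set x | f x != 0]).
  set B := closure (mball d 1%g r).
  have cB : compact B by rewrite -precompactE; exact: Defs.metric_proper Hd _ _.
  have cKB := compact_mulset cK cB.
  apply: (subclosed_compact _ cKB); first exact: closed_closure.
  rewrite [X in _ `<=` X](closure_id _).1; last exact: compact_closed.
  apply: closureS => x /= /fnear[k Kk kx]; exists k => //.
  exists (k^-1 * x)%g; last by rewrite mulVKg.
  apply: subset_closure; rewrite /mball /= -(Defs.metric_left_invariant Hd k).
  by rewrite mulg1 mulVKg.
exists (MkCc cf sf); split=> //= x.
  rewrite /f le_max lexx/= ge_max ler01/= gerBl; exact: divr_ge0 (ltW r0).
move=> Kx; rewrite /f (_ : del x = 0) ?mul0r ?subr0 ?max_r ?ler01//.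
by apply/le_anti; rewrite del_ge0 andbT -[leRHS](Defs.metric_eq0 Hd x x).2// del_le.
Unshelve. all: by end_near. Qed.

Lemma pairing_sandwich (mu : radon R G) (f : Cc R G) (A W : set G) :
  measurable (A : set (borel G)) -> measurable (W : set (borel G)) ->
  (mu W < +oo)%E ->
  (forall x, 0 <= f x <= 1) -> (forall x, A x -> f x = 1) ->
  (forall x, f x != 0 -> W x) ->
  vol mu A <= radon_pairing mu f <= vol mu W.
Proof.
move=> mA mW Wfin f01 fA fW.
have mf : measurable_fun [set: borel G] (EFin \o f).
  by apply/measurable_EFinP; apply: continuous_real_borel; exact: Cc_continuous.
have f0 x : (0 <= (f x)%:E)%E by rewrite lee_fin; have /andP[] := f01 x.
have int1 (B : set (borel G)) : measurable B ->
    mu B = (\int[mu]_x (\1_B x)%:E)%E.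
  by move=> mB; rewrite integral_indic// setIT.
have m1 (B : set (borel G)) : measurable B ->
    measurable_fun [set: borel G] (fun x => (\1_B x : R)%:E).
  by move=> mB; apply/measurable_EFinP; exact: measurable_indic.
have Af : (mu A <= \int[mu]_x (f x)%:E)%E.
  rewrite int1//; apply: ge0_le_integral => //; first exact: m1.
  move=> x _; rewrite lee_fin indicE; have [/set_mem/fA->|_] := boolP (x \in A) => //=.
  by have /andP[] := f01 x.
have fWi : (\int[mu]_x (f x)%:E <= mu W)%E.
  rewrite int1//; apply: ge0_le_integral => //; first exact: m1.
  move=> x _; rewrite lee_fin indicE; have /andP[f0x f1x] := f01 x.
  have [->|/fW Wx] := eqVneq (f x) 0; first exact: ler0n.
  by rewrite mem_set.
have ffin : (\int[mu]_x (f x)%:E)%E \is a fin_num.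
  rewrite ge0_fin_numE ?integral_ge0//; exact: le_lt_trans Wfin.
apply/andP; split; apply: fine_le => //.
- by rewrite ge0_fin_numE//; apply: le_lt_trans Wfin; exact: le_trans fWi.
- by rewrite ge0_fin_numE.
Qed.

End Testing.

Section Hull.
Variables (R : realType) (G : topGroupType) (L : wdelone R G).

Lemma comb_act g (A : set G) : comb (act g L) A = comb L (ltrans g^-1%g A).
Proof.
rewrite /comb /= /comb_fun !setIT.
rewrite (@reindex_esum _ _ _ (pts L `&` ltrans g^-1%g A) _ (fun x => (g * x)%g)).
  by apply: eq_esum => x _; rewrite /= mulKg.
split.
- move=> x [Px]; rewrite ltransE /= invgK => Ax; split=> //.
  by rewrite /= ltransE /= mulKg.
- by move=> x y _ _ /mulgI.
- move=> x [/=]; rewrite ltransE /= => Px Ax; exists (g^-1 * x)%g; rewrite ?mulVKg//.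
  by split=> //; exists x.
Qed.

(** Evaluation at a test function is weak-* continuous, so closed conditions
    on it pass from the orbit to its closure. *)
Lemma hull_pairing (f : Cc R G) (a b : R) :
  (forall g, a <= radon_pairing (comb (act g L)) f <= b) ->
  forall Pi, hull L Pi -> a <= radon_pairing Pi f <= b.
Proof.
move=> Hab Pi HPi.
pose ev : radon R G -> R := fun mu => radon_pairing mu f.
have cev : continuous ev.
  move=> mu; apply: (@continuous_comp _ _ _ (@radon_pairing R G)
    (fun h : {ptws Cc R G -> R} => h f)).
    exact: initial_continuous.
  exact: proj_continuous.
have clE : closed (ev @^-1` `[a, b]).
  by apply: preimage_closed; [move=> x _; exact: cev|exact: itv_closed].
have : (ev @^-1` `[a, b]) Pi.
  rewrite [X in X Pi](closure_id _).1//; apply: closureS HPi.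
  by move=> _ [g _ <-]; rewrite /= in_itv /=; exact: Hab.
by rewrite /= in_itv.
Qed.

End Hull.

(** * Real-valued volumes of relatively compact sets *)

Section Volumes.
Variables (R : realType) (G : topGroupType).
Hypothesis hG : hausdorff_space G.
Implicit Types (mu : radon R G) (A B K : set G).

Lemma vol_ge0 mu A : 0 <= vol mu A.
Proof. exact: fine_ge0. Qed.

Lemma radon_fin_num mu A K : measurable (A : set (borel G)) -> compact K ->
  A `<=` K -> mu A \is a fin_num.
Proof.
move=> mA cK AK; rewrite ge0_fin_numE//.
apply: le_lt_trans (radon_compact mu cK); apply: le_measure; rewrite ?inE//.
exact: compact_borel.
Qed.

Lemma EFin_vol mu A K : measurable (A : set (borel G)) -> compact K ->
  A `<=` K -> (vol mu A)%:E = mu A.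
Proof. by move=> mA cK AK; rewrite fineK//; exact: radon_fin_num mA cK AK. Qed.

Lemma le_vol mu A B K : measurable (A : set (borel G)) ->
  measurable (B : set (borel G)) -> compact K -> A `<=` B -> B `<=` K ->
  vol mu A <= vol mu B.
Proof.
move=> mA mB cK AB BK; apply: fine_le.
- by apply: radon_fin_num mA cK _ => x /AB /BK.
- exact: radon_fin_num mB cK BK.
- by apply: le_measure; rewrite ?inE.
Qed.

Lemma volD mu A B K : measurable (A : set (borel G)) ->
  measurable (B : set (borel G)) -> compact K -> A `<=` K -> B `<=` A ->
  vol mu (A `\` B) = vol mu A - vol mu B.
Proof.
move=> mA mB cK AK BA.
have BAe : A `&` B = B by exact: setIidr.
rewrite /vol measureD//; last by rewrite -ge0_fin_numE//; exact: radon_fin_num mA cK AK.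
rewrite BAe fineB//; first exact: radon_fin_num mA cK AK.
by apply: radon_fin_num mB cK _ => x /BA /AK.
Qed.

Lemma volU2 mu A B K : measurable (A : set (borel G)) ->
  measurable (B : set (borel G)) -> compact K -> A `<=` K -> B `<=` K ->
  vol mu (A `|` B) <= vol mu A + vol mu B.
Proof.
move=> mA mB cK AK BK; rewrite -lee_fin EFinD.
rewrite !(@EFin_vol _ _ K)//; last 2 first.
- exact: measurableU.
- by move=> x [/AK|/BK].
exact: measureU2.
Qed.

End Volumes.

(** * Boundaries and erosions *)

Section Boundary.
Variable G : topGroupType.
Implicit Types (D S V : set G).

Lemma boundaryE D S :
  boundary D S = mulset (invset D) S `&` mulset (invset D) (~` S).
Proof.
have H B : [set g | (rtrans D g `&` B) !=set0] = mulset (invset D) B.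
  apply/seteqP; split=> [g [_ [[a Da <-] Bag]]|_ [_ [a Da <-] [b Bb <-]]].
    exists a^-1%g; first by exists a.
    by exists (a * g)%g => //; rewrite mulKg.
  by exists b; split=> //; exists a => //; rewrite mulVKg.
by rewrite /boundary -!H.
Qed.

Lemma boundary_borel D S : hausdorff_space G -> compact D -> compact S ->
  measurable (boundary D S : set (borel G)).
Proof.
move=> hG cD cS; rewrite boundaryE; apply: measurableI.
  by apply: compact_borel => //; apply: compact_mulset => //; exact: compact_invset.
apply: open_borel; apply: open_mulset; apply: closed_openC.
exact: compact_closed.
Qed.

Lemma boundary_sub D S : boundary D S `<=` mulset (invset D) S.
Proof. by rewrite boundaryE => x []. Qed.

Lemma not_boundary D S t u : D 1%g -> S t -> ~ boundary D S t -> D u -> S (u * t)%g.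
Proof.
move=> D1 St nb Du; apply: contrapT => nS; apply: nb; split.
  by exists t; split=> //; exists 1%g => //; rewrite mul1g.
by exists (u * t)%g; split=> //; exists u.
Qed.

(** Enlarging D by a neighbourhood V of the identity upgrades membership to
    membership in the interior. This is why the boundaries below are taken
    with respect to T 1 times T j: repetitivity speaks of interiors. *)
Lemma not_boundary_interior V D S t u : nbhs 1%g V -> D 1%g ->
  S t -> ~ boundary (mulset V D) S t -> D u -> S° (u * t)%g.
Proof.
move=> V1 D1 St nb Du.
have VD1 : mulset V D 1%g.
  by exists 1%g; [exact: nbhs_singleton|exists 1%g; rewrite ?mul1g].
have : nbhs (u * t)%g (rtrans V (u * t)%g).
  rewrite rtransE; apply: (@rmul_continuous _ (u * t)^-1%g).
  by rewrite /= mulgV.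
apply: filterS => _ [v Vv <-]; rewrite mulgA.
by apply: not_boundary nb _ => //; exists v => //; exists u.
Qed.

(** The Minkowski erosion of S by V, with V acting on the left. *)
Definition erosion V S : set G := [set t | forall u, V u -> S (u * t)%g].

Lemma compact_erosion V S : hausdorff_space G -> V 1%g -> compact S -> compact (erosion V S).
Proof.
move=> hG V1 cS; apply: (subclosed_compact _ cS) => [|t /(_ _ V1)]; last by rewrite mul1g.
rewrite (_ : erosion V S = \bigcap_(u in V) ltrans u^-1%g S).
  apply: closed_bigI => u _; apply: compact_closed => //; exact: compact_ltrans.
by apply/seteqP; split=> t H u /H; rewrite ltransE /= invgK.
Qed.

End Boundary.

(** * Densities along a strong Folner exhaustion *)

Section Densities.
Variables (R : realType) (G : topGroupType).
Hypotheses (hG : hausdorff_space G) (sG : @second_countable G).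
Variable m : radon R G.
Hypothesis linv : forall g (A : set (borel G)), measurable A -> m (ltrans g A) = m A.
Hypothesis rinv : forall g (A : set (borel G)), measurable A -> m (rtrans A g) = m A.
Variable T : nat -> set G.
Hypothesis HT : strong_folner_exhaustion m T.
Variable L : wdelone R G.

Let v n := vol m (T n).
Let N n h := vol (comb L) (ltrans h (invset (T n))).

Let cT n : compact (T n). Proof. exact: folner_compact HT n. Qed.
Let mT n : measurable (T n : set (borel G)). Proof. exact: compact_borel. Qed.
Let cTi n : compact (invset (T n)). Proof. exact: compact_invset. Qed.
Let T1 n : T n 1%g. Proof. exact: folner_one HT n. Qed.

Lemma folner_vol_gt0 n : 0 < v n.
Proof. by rewrite -lte_fin (EFin_vol hG m (mT n) (@cT n))//; exact: folner_pos HT n. Qed.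

Lemma folner_mono k n : (k <= n)%N -> T k `<=` T n.
Proof.
move=> kn; rewrite -(subnK kn); elim: (n - k)%N => // p IHp x /IHp.
by move=> /(folner_incr HT); exact: interior_subset.
Qed.

Lemma folner_nbhs1 : nbhs 1%g (T 1).
Proof. by move: (T1 0%N) => /(folner_incr HT). Qed.

Lemma vol_invset A : measurable (A : set (borel G)) ->
  vol m (invset A) = vol m A.
Proof.
move=> mA; congr fine.
exact: (haar_invset hG sG (@cT) (folner_exhaust HT) linv rinv mA (@cT 0%N) (folner_pos HT 0%N)).
Qed.

Lemma vol_ltrans g A : measurable (A : set (borel G)) ->
  vol m (ltrans g A) = vol m A.
Proof. by move=> mA; rewrite /vol linv. Qed.

Lemma density_bound j (c : R) A W K : (forall h, N j h <= c * v j) ->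
  measurable (A : set (borel G)) -> measurable (W : set (borel G)) ->
  compact K -> W `<=` K -> mulset A (T j) `<=` W ->
  vol (comb L) A <= c * vol m W.
Proof.
move=> Nc mA mW cK WK AW.
have AK : A `<=` K by move=> x Ax; apply/WK/AW/sub_mulset_one.
have muc h : (comb L (ltrans h (invset (T j))) <= (c * v j)%:E)%E.
  rewrite -(EFin_vol hG (comb L) _ (@compact_ltrans _ h _ (@cTi j)))//.
    by rewrite lee_fin; exact: Nc.
  by apply: ltrans_borel; exact: compact_borel.
have := averaging hG sG (@cT) (folner_exhaust HT) linv mA (mT j) mW AW muc.
rewrite -(EFin_vol hG m (mT j) (@cT j))// -(EFin_vol hG m mW cK)//.
rewrite -(EFin_vol hG (comb L) mA cK)// -!EFinM lee_fin.
by rewrite -mulrA [leRHS]mulrCA ler_pM2l//; exact: folner_vol_gt0.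
Qed.

Lemma folner_mulset K (e : R) : compact K -> K !=set0 -> 0 < e ->
  \forall n \near \oo, vol m (mulset K (T n)) <= (1 + e) * v n.
Proof.
move=> cK K0 e0; have := folner_inv HT cK K0.
move=> /cvgrPdist_lt /(_ e e0); apply: filterS => n.
have cKT : compact (mulset K (T n)) by exact: compact_mulset.
have mKT := compact_borel hG cKT.
rewrite sub0r normrN => /(le_lt_trans (ler_norm _)).
rewrite ltr_pdivrMr; last exact: folner_vol_gt0.
move=> /ltW Y_le; rewrite mulrDl mul1r.
have cU := compactU (@cT n) cKT.
have mY : measurable (T n `+` mulset K (T n) : set (borel G)).
  by apply: measurableU; exact: measurableD.
have YU : T n `+` mulset K (T n) `<=` T n `|` mulset K (T n).
  by move=> x [[? _]|[? _]]; [left|right].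
apply: le_trans (lerD (lexx _) Y_le).
apply: le_trans (volU2 hG m (mT n) mY cU _ YU); last exact: subsetUl.
apply: (le_vol hG m) cU _ _ => //; first exact: measurableU.
  move=> x Kx; have [Tx|nTx] := pselect (T n x); first by left.
  by right; right.
by move=> x [|/YU//]; left.
Qed.

Lemma folner_boundary_le K (e : R) : compact K -> 0 < e ->
  \forall n \near \oo, vol m (boundary K (T n)) <= e * v n.
Proof.
move=> cK e0; have := folner_boundary HT cK.
move=> /cvgrPdist_lt /(_ e e0); apply: filterS => n.
rewrite sub0r normrN => /(le_lt_trans (ler_norm _)).
by rewrite ltr_pdivrMr ?folner_vol_gt0// => /ltW.
Qed.

(** The number b is the infimum over n of the supremum over h of N n h / v n;
    the two clauses after 0 <= b unfold the infimum and the supremum. *)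
Lemma upper_density_exists : exists b : R, [/\ 0 <= b,
  forall e, 0 < e -> exists j, forall h, N j h <= (b + e) * v j &
  forall e n, 0 < e -> exists h, (b - e) * v n <= N n h].
Proof.
pose D n := [set N n h / v n | h in [set: G]].
have subD n : has_sup (D n).
  split; first by exists (N n 1%g / v n); exists 1%g.
  have [M HM] := comb_translation_bounded L (@cTi n).
  exists (M / v n) => _ [h _ <-]; rewrite ler_pM2r ?invr_gt0 ?folner_vol_gt0//.
  rewrite -lee_fin (EFin_vol hG _ _ (@compact_ltrans _ h _ (@cTi n)))//.
  by apply: ltrans_borel; exact: compact_borel.
have N0 n h : 0 <= N n h / v n by rewrite divr_ge0 ?vol_ge0.
have D0 n : 0 <= sup (D n).
  by apply: le_trans (N0 n 1%g) _; apply: ub_le_sup; [case: (subD n)|exists 1%g].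
pose B := range (fun n => sup (D n)).
have infB : has_inf B.
  by split; [exists (sup (D 0%N)); exists 0%N|exists 0 => _ [n _ <-]].
exists (inf B); split.
- by apply: lb_le_inf => [|_ [n _ <-]//]; case: infB.
- move=> e e0; have [_ [j _ <-] je] := inf_adherent e0 infB.
  exists j => h; rewrite -ler_pdivrMr ?folner_vol_gt0//; apply: le_trans (ltW je).
  by apply: ub_le_sup; [case: (subD j)|exists h].
- move=> e n e0; have [_ [h _ <-] he] := sup_adherent e0 (subD n).
  exists h; rewrite -ler_pdivlMr ?folner_vol_gt0//; apply: le_trans (ltW he).
  by rewrite lerD2r; apply: ge_inf; [case: infB|exists n].
Qed.

Lemma boundary_bounded K n : compact K ->
  boundary K (T n) `<=` mulset (invset K) (T n) /\ compact (mulset (invset K) (T n)).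
Proof.
move=> cK; split; first exact: boundary_sub.
by apply: compact_mulset; [exact: compact_invset|exact: cT].
Qed.

(** If a translate of the interior of a small window lies in a large window,
    then every product of a remaining point of the large window with an
    element of T j avoids that translate, up to the boundary of the small
    window. So [density_bound] charges the remainder only for the difference
    of the two volumes, up to boundary terms. *)
Lemma density_outside_patch j (c : R) k n g h :
  (forall h, N j h <= c * v j) ->
  ltrans g (invset (T k)°) `<=` ltrans h (invset (T n)) ->
  vol (comb L) (ltrans h (invset (T n)) `\` ltrans g (invset (T k)°)) <=
    c * (vol m (mulset (invset (T j)) (T n))
         - (v k - vol m (boundary (mulset (T 1) (T j)) (T k)))).
Proof.
move=> Nj SB; set S := ltrans g (invset (T k)°); set K := mulset (T 1) (T j).
have c0 : 0 <= c.
  rewrite -(pmulr_lge0 _ (folner_vol_gt0 j)).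
  exact: le_trans (vol_ge0 _ _) (Nj 1%g).
have cK : compact K by exact: compact_mulset.
have mS : measurable (S : set (borel G)).
  by apply: open_borel; apply: open_ltrans; apply: open_invset; exact: open_interior.
have mB : measurable (ltrans h (invset (T n)) : set (borel G)).
  by apply: ltrans_borel; exact: compact_borel.
pose E := ltrans g (invset (T k `\` boundary K (T k))).
have mbK : measurable (boundary K (T k) : set (borel G)) by exact: boundary_borel.
have mE0 : measurable (T k `\` boundary K (T k) : set (borel G)) by exact: measurableD.
have mE : measurable (E : set (borel G)).
  by apply: ltrans_borel; exact: invset_borel.
have cF : compact (mulset (ltrans h (invset (T n))) (T j)).
  by apply: compact_mulset => //; exact: compact_ltrans.
have mF := compact_borel hG cF.
have in_interior t u : T k t -> ~ boundary K (T k) t -> T j u -> (T k)° (u * t)%g.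
  by move=> Tt nb Tu; apply: not_boundary_interior nb Tu => //; exact: folner_nbhs1.
have ES : E `<=` S.
  apply: ltrans_sub; apply: invset_sub => t [Tt nb].
  by have := in_interior t 1%g Tt nb (T1 j); rewrite mul1g.
have EF : E `<=` mulset (ltrans h (invset (T n))) (T j).
  by move=> x /ES /SB; exact: sub_mulset_one.
have AW : mulset (ltrans h (invset (T n)) `\` S) (T j) `<=`
    mulset (ltrans h (invset (T n))) (T j) `\` E.
  move=> _ [a [Ba nSa] [u Tu <-]]; split; first by exists a => //; exists u.
  rewrite /E ltransE invsetE /= invgM invgM invgK => -[Tt nb]; apply: nSa.
  rewrite /S ltransE invsetE /= invgM invgK.
  by have := in_interior _ _ Tt nb Tu; rewrite !mulgA mulgV mul1g.
have mA : measurable (ltrans h (invset (T n)) `\` S : set (borel G)).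
  exact: measurableD.
have mW : measurable (mulset (ltrans h (invset (T n))) (T j) `\` E : set (borel G)).
  exact: measurableD.
apply: le_trans (density_bound Nj mA mW cF _ AW) _; first by move=> x [].
apply: ler_wpM2l => //; rewrite (volD hG m mF mE cF)//; apply: lerB.
  rewrite mulset_ltrans vol_ltrans; last first.
    by apply: compact_borel hG _; exact: compact_mulset.
  rewrite -vol_invset; last by apply: compact_borel hG _; exact: compact_mulset.
  by rewrite invset_mulset invsetK.
rewrite /E vol_ltrans ?vol_invset//; last exact: invset_borel.
rewrite lerBlDr.
have [bK cbK] := boundary_bounded k cK.
have cU := compactU (@cT k) cbK.
apply: le_trans (volU2 hG m mE0 mbK cU _ _); last 2 first.
- by move=> x [Tx _]; left.
- by move=> x bx; right; exact: bK.
apply: (le_vol hG m (mT k) _ cU) => [|x Tx|x [[Tx _]|bx]].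
- exact: measurableU.
- by have [bx|nbx] := pselect (boundary K (T k) x); [right|left].
- by left.
- by right; exact: bK.
Qed.

Variable b : R.
Hypothesis b0 : 0 <= b.
Hypothesis b_inf : forall e, 0 < e -> exists j, forall h, N j h <= (b + e) * v j.
Hypothesis b_sup : forall e n, 0 < e -> exists h, (b - e) * v n <= N n h.

(** The bound at one nearly optimal scale j propagates to all large scales by
    [density_bound]. The extra factor C costs nothing in the limit and leaves
    room for the bump functions. *)
Lemma density_le C (e : R) : compact C -> C !=set0 -> 0 < e ->
  \forall n \near \oo, forall h,
    vol (comb L) (ltrans h (mulset (invset (T n)) C)) <= (b + e) * v n.
Proof.
move=> cC [c0 Cc0] e0.
have e20 : 0 < e / 2 by rewrite divr_gt0.
have [j Nj] := b_inf e20.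
pose q := (e / 2) / (b + e / 2).
have q0 : 0 < q by rewrite divr_gt0// ltr_wpDl.
have cK : compact (invset (mulset C (T j))).
  by apply: compact_invset; exact: compact_mulset.
have K0 : invset (mulset C (T j)) !=set0.
  by exists (c0^-1)%g; exists c0 => //; exists c0 => //; exists 1%g; rewrite ?mulg1.
apply: filterS (folner_mulset cK K0 q0) => n Hn h.
have cA : compact (mulset (invset (T n)) C) by exact: compact_mulset.
have cW : compact (mulset (mulset (invset (T n)) C) (T j)) by exact: compact_mulset.
have chW := @compact_ltrans _ h _ cW.
apply: (@le_trans _ _ ((b + e / 2) * vol m (ltrans h (mulset (mulset (invset (T n)) C) (T j))))).
  apply: density_bound Nj _ _ chW _ _ => //.
  - by apply: compact_borel => //; exact: compact_ltrans.
  - by apply: compact_borel hG _; exact: compact_ltrans.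
  - by rewrite mulset_ltrans.
rewrite vol_ltrans; last exact: compact_borel.
rewrite -vol_invset; last exact: compact_borel.
rewrite -mulsetA invset_mulset invsetK.
apply: (@le_trans _ _ ((b + e / 2) * ((1 + q) * v n))).
  by rewrite ler_pM2l// ltr_wpDl.
rewrite mulrA ler_pM2r ?folner_vol_gt0// mulrDr mulr1 /q mulrCA divff ?mulr1.
  by rewrite -addrA -splitr.
by rewrite gt_eqF// ltr_wpDl.
Qed.

(** The part of a window lost by erosion is made of boundary points, and stays
    so after multiplication by T j; hence its mass is negligible. *)
Lemma complement_erosion_boundary h k j :
  mulset (ltrans h (invset (T k)) `\` ltrans h (invset (erosion (T 1) (T k)))) (T j)
    `<=` ltrans h (invset (boundary (mulset (T 1) (T j)) (T k))).
Proof.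
move=> _ [x [+ nx] [u Tu <-]]; rewrite ltransE invsetE /= invgM invgK => Tx.
have [w [Tw nTw]] : exists w, T 1 w /\ ~ T k (w * (x^-1 * h))%g.
  apply: contrapT => nw; apply: nx.
  rewrite ltransE invsetE /= /erosion /= invgM invgK => w Tw.
  by apply: contrapT => nTw; apply: nw; exists w.
rewrite ltransE invsetE /= !invgM invgK; split.
  exists (x^-1 * h)%g; split=> //; exists u; last by rewrite !mulgA mulgV mul1g.
  by exists 1%g; [exact: T1|exists u; rewrite ?mul1g].
exists (w * (x^-1 * h))%g; split=> //; exists (w * u)%g.
  by exists w => //; exists u.
by rewrite -!mulgA mulVKg.
Qed.

Lemma density_erosion_ge :
  (forall e, 0 < e -> \forall n \near \oo, forall h, (b - e) * v n <= N n h) ->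
  forall e, 0 < e -> \forall n \near \oo, forall h,
    (b - e) * v n <= vol (comb L) (ltrans h (invset (erosion (T 1) (T n)))).
Proof.
move=> lower e e0.
(* Any scale with a uniform upper bound will do here. *)
have [j Nj] := b_inf ltr01.
have b1 : 0 < b + 1 by rewrite ltr_wpDl.
pose K := mulset (T 1) (T j).
have cK : compact K by exact: compact_mulset.
have q0 : 0 < e / 2 / (b + 1) by rewrite !divr_gt0.
have e20 : 0 < e / 2 by rewrite divr_gt0.
near=> n; move=> h.
have Hlow : (b - e / 2) * v n <= N n h by move: h; near: n; exact: lower.
have Hbd : vol m (boundary K (T n)) <= e / 2 / (b + 1) * v n.
  by near: n; exact: folner_boundary_le.
have cC : compact (ltrans h (invset (erosion (T 1) (T n)))).
  by apply: compact_ltrans; apply: compact_invset; exact: compact_erosion.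
have cA : compact (ltrans h (invset (T n))) by exact: compact_ltrans.
have CA : ltrans h (invset (erosion (T 1) (T n))) `<=` ltrans h (invset (T n)).
  apply/ltrans_sub/invset_sub => t /(_ _ (T1 1)); by rewrite mul1g.
have mC := compact_borel hG cC; have mA := compact_borel hG cA.
have mB : measurable (boundary K (T n) : set (borel G)) by exact: boundary_borel.
have [BK cBK] := boundary_bounded n cK.
have diff : vol (comb L) (ltrans h (invset (T n)) `\` ltrans h (invset (erosion (T 1) (T n))))
    <= (b + 1) * vol m (boundary K (T n)).
  rewrite -vol_invset// -(vol_ltrans h); last exact: invset_borel.
  have cB : compact (ltrans h (invset (mulset (invset K) (T n)))).
    by apply: compact_ltrans; exact: compact_invset.
  apply: (density_bound Nj _ _ cB _ (complement_erosion_boundary (j := j))).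
  - exact: measurableD.
  - by apply: ltrans_borel; exact: invset_borel.
  - exact/ltrans_sub/invset_sub.
rewrite (volD hG (comb L) mA mC cA _ CA)// in diff.
have : (b + 1) * vol m (boundary K (T n)) <= e / 2 * v n.
  apply: le_trans (ler_wpM2l (ltW b1) Hbd) _.
  by rewrite mulrA mulrCA divff ?mulr1// gt_eqF.
rewrite -/(N n h) in diff; move: Hlow diff; rewrite !mulrBl.
have : e * v n = e / 2 * v n + e / 2 * v n by rewrite -mulrDl -splitr.
lra.
Unshelve. all: by end_near. Qed.

Variable d : G -> G -> R.
Hypothesis Hd : continuous_adapted_metric d.

Lemma zeta_gt0_repetitivity e k : 0 < zeta d m T L e ->
  exists n, repetitivity d T L e k = Some n /\ zeta d m T L e <= v k / v n.
Proof.
rewrite /zeta; case: asboolP => [|nex _]; first by rewrite ltxx.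
case E : (repetitivity d T L e k) => [n|]; last by exfalso; apply: nex; exists k.
exists n; split=> //; apply: ge_inf; last by exists k, n.
by exists 0 => _ [k' [n' [_ ->]]]; rewrite divr_ge0 ?vol_ge0.
Qed.

(** Patterns are classes of patches up to translation, so a first translation
    g0 comes from the representative and a second one g1 from the occurrence;
    only their product matters. *)
Lemma repetitivity_occurs e k n h0 h : repetitivity d T L e k = Some n ->
  exists g0 g1, let X := ltrans h0 (invset (T k)°) in
    ltrans (g1 * g0)%g X `<=` ltrans h (invset (T n)°) /\
    exists2 mu : radon R G,
      forall A, mu A = comb L ((fun x => (g1 * g0 * x)%g) @^-1` A `&` X) &
      (dist_on d (ltrans (g1 * g0)%g X) mu (comb_on L (ltrans (g1 * g0)%g X)) < e%:E)%E.
Proof.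
rewrite /repetitivity /nat_inf; case: pselect => // ex [<-].
case: ex_minnP => p /asboolP Hp _.
set X := ltrans h0 (invset (T k)°).
have PX : patterns L (invset (T k)°) (pattern_of (patch_of L X)) by exists h0.
have [_ [g0 _ <-] [g1 /= gT dg]] := Hp _ PX h.
rewrite -/X !(ltransM g1 g0 X) in gT dg.
exists g0, g1; split=> //; exists (push (push (comb_on L X) g0) g1) => // A.
rewrite -comb_onE /= /push_fun /pushforward /= /push_fun /pushforward.
by congr (comb_fun L X _); apply/seteqP; split=> x /=; rewrite mulgA.
Qed.

(** Here q is the excess of the density at scale j over b, n1 and k1 are the
    volumes of the large and the small window, Nn and Nk their masses, Sv the
    mass of the copy of the small patch, and eta a relative error. *)
Lemma patch_mass_arith (q eta n1 k1 Nk Nn Sv eps : R) :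
  Nn - Sv <= (b + q) * ((1 + eta) * n1 - (k1 - eta * k1)) ->
  Sv <= Nk + eps / 4 * k1 -> (b - eta) * n1 <= Nn ->
  eta * (1 + 2 * (b + q)) * n1 <= eps / 4 * k1 -> q * n1 <= eps / 4 * k1 ->
  (b + q) * (eta * k1) <= (b + q) * (eta * n1) ->
  0 <= q * k1 -> 0 <= eps * k1 -> (b - eps) * k1 <= Nk.
Proof. by lra. Qed.

(** A poor window would reappear, by repetitivity, inside every window of
    comparable volume, also inside one of nearly maximal density; there the
    remainder cannot make up for the deficit. *)
Lemma repetitive_density_ge : almost_tempered_repetitive d m T L ->
  forall e, 0 < e -> \forall n \near \oo, forall h, (b - e) * v n <= N n h.
Proof.
move=> Hrep eps eps0.
have [r0 [s [r00 s1 occ]]] := occurrence_mass L Hd.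
have b1 : 0 < b + 1 by rewrite ltr_wpDl.
have s0 : 0 < s by exact: lt_le_trans s1.
(* The first three bounds make e admissible for zeta and for occurrence_mass;
   the last one bounds the mass lost in a copy by eps / 4 * v k. *)
pose e := Num.min (Num.min (1 / 2) (r0 / 2)) (Num.min ((2 * s)^-1) (eps / 4 / (s * (b + 1)))).
have e0 : 0 < e.
  by rewrite !lt_min !divr_gt0 ?invr_gt0 ?mulr_gt0.
have e1 : e <= 1 / 2 by rewrite /e !ge_min lexx.
have er0 : e < r0.
  apply: (@le_lt_trans _ _ (r0 / 2)); first by rewrite /e !ge_min lexx !orbT.
  lra.
have es1 : e * s < 1.
  apply: (@le_lt_trans _ _ ((2 * s)^-1 * s)).
    by rewrite ler_pM2r// /e !ge_min lexx !orbT.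
  by rewrite invfM -mulrA mulVf ?gt_eqF// mulr1; lra.
have esb : e * s * (b + 1) <= eps / 4.
  by rewrite -mulrA -ler_pdivlMr ?mulr_gt0// /e !ge_min lexx !orbT.
have z0 : 0 < zeta d m T L e by apply: Hrep; rewrite e0/=; lra.
pose z := Num.min 1 (zeta d m T L e).
have zgt0 : 0 < z by rewrite lt_min ltr01.
have zle1 : z <= 1 by rewrite ge_min lexx.
(* The error at scale j must be small compared with z, since it is spread over
   the large window, whose volume can be 1/z times that of the small one. *)
have [j Nj] : exists j, forall h, N j h <= (b + z * eps / 4) * v j.
  by apply: b_inf; rewrite divr_gt0// mulr_gt0.
set beta := b + z * eps / 4 in Nj.
have beta0 : 0 <= beta by rewrite addr_ge0// divr_ge0// mulr_ge0 ?ltW.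
(* With this eta, the Folner and boundary errors of both windows together cost
   at most eps / 4 * v k; see zeta_le below. *)
pose eta := z * eps / 4 / (1 + 2 * beta).
have eta0 : 0 < eta.
  by rewrite !divr_gt0 ?mulr_gt0// ltr_pwDl// mulr_ge0.
pose K := mulset (T 1) (T j).
have cK : compact K by exact: compact_mulset.
near=> k; move=> h0.
have HbdK : vol m (boundary K (T k)) <= eta * v k.
  by near: k; exact: folner_boundary_le.
have Hup h : vol (comb L) (ltrans h (mulset (invset (T k)) [set 1%g])) <= (b + 1) * v k.
  by move: h; near: k; apply: density_le => //; [exact: compact_set1|exists 1%g].
have HFol : forall n, (k <= n)%N ->
    vol m (mulset (invset (T j)) (T n)) <= (1 + eta) * v n.
  near: k.
  have : \forall n \near \oo, vol m (mulset (invset (T j)) (T n)) <= (1 + eta) * v n.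
    by apply: folner_mulset => //; exists 1%g; exists 1%g; rewrite ?invg1.
  by case=> k1 _ Hk1; exists k1 => // k' /= k1k' n k'n; apply: Hk1; exact: leq_trans k'n.
have [n0 [rn0 zn0]] := zeta_gt0_repetitivity k z0.
(* Occurrence in windows of size n0 implies occurrence in larger ones; the
   maximum ensures that n tends to infinity with k and that T k lies in T n,
   also when G is compact. *)
pose n := maxn n0 k.
have kn : (k <= n)%N by exact: leq_maxr.
have zv : z * v n <= v k.
  rewrite /n /maxn; case: ifP => _.
    by rewrite ler_piMl ?vol_ge0.
  rewrite -ler_pdivlMr ?folner_vol_gt0//; apply: le_trans zn0.
  by rewrite ge_min lexx orbT.
have vkn : v k <= v n.
  by apply: (le_vol hG m (mT k) (mT n) (@cT n)) => //; exact: folner_mono.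
have [h Nh] := b_sup n eta0.
have [g0 [g1 /= [ST [mu muE mudist]]]] := repetitivity_occurs h0 h rn0.
set X := ltrans h0 (invset (T k)°) in ST muE mudist.
set S := ltrans (g1 * g0)%g X in ST muE mudist.
have SE : S = ltrans (g1 * g0 * h0)%g (invset (T k)°) by rewrite /S /X ltransM.
have oS : open S.
  by rewrite SE; apply: open_ltrans; apply: open_invset; exact: open_interior.
have mS := open_borel oS.
have Tk_sub g : ltrans g (invset (T k)°) `<=` ltrans g (invset (T k)).
  by apply: ltrans_sub; apply: invset_sub; exact: interior_subset.
have mX : measurable (X : set (borel G)).
  by apply: open_borel; apply: open_ltrans; apply: open_invset; exact: open_interior.
have ckT g : compact (ltrans g (invset (T k))).
  by apply: compact_ltrans; exact: compact_invset.
have mkT g := compact_borel hG (ckT g).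
have cB : compact (ltrans h (invset (T n))).
  by apply: compact_ltrans; exact: compact_invset.
have mB := compact_borel hG cB.
have Sk : S `<=` ltrans (g1 * g0 * h0)%g (invset (T k)) by rewrite SE; exact: Tk_sub.
have massS : vol (comb L) S <= N k h0 + eps / 4 * v k.
  have finS : finite_set (pts L `&` S).
    apply: sub_finite_set (finite_pts L (ckT (g1 * g0 * h0)%g)).
    exact: setIS.
  have := occ e (g1 * g0)%g X mu _ es1 finS muE mudist.
  rewrite e0 er0 => /(_ isT).
  rewrite -(EFin_vol hG (comb L) mS (ckT (g1 * g0 * h0)%g))//.
  rewrite -(EFin_vol hG (comb L) mX (ckT h0))//; last exact: Tk_sub.
  rewrite -EFinM lee_fin => SX.
  have XN : vol (comb L) X <= N k h0.
    by apply: (le_vol hG (comb L) mX (mkT h0) (ckT h0)) => //; exact: Tk_sub.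
  have Sle : vol (comb L) S <= (b + 1) * v k.
    apply: le_trans (Hup (g1 * g0 * h0)%g).
    have c1 : compact (ltrans (g1 * g0 * h0)%g (mulset (invset (T k)) [set 1%g])).
      by apply: compact_ltrans; apply: compact_mulset => //; exact: compact_set1.
    apply: (le_vol hG (comb L) mS (compact_borel hG c1) c1) => //.
    apply: subset_trans Sk _; apply: ltrans_sub; exact: sub_mulset_one.
  have : e * s * vol (comb L) S <= eps / 4 * v k.
    apply: (@le_trans _ _ (e * s * ((b + 1) * v k))).
      by rewrite ler_pM2l// mulr_gt0.
    by rewrite mulrA ler_pM2r// folner_vol_gt0.
  by move: SX XN; rewrite mulrBl mul1r; lra.
have SB : S `<=` ltrans h (invset (T n)).
  apply: subset_trans ST _; apply: ltrans_sub; apply: invset_sub.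
  by apply: subset_trans (@interior_subset _ _) _; apply: folner_mono; exact: leq_maxl.
have massA : vol (comb L) (ltrans h (invset (T n)) `\` S) <=
    beta * ((1 + eta) * v n - (v k - eta * v k)).
  rewrite SE in SB *; apply: le_trans (density_outside_patch Nj SB) _.
  by apply: ler_wpM2l => //; apply: lerB; [exact: HFol|exact: lerB].
rewrite (volD hG (comb L) mB mS cB _ SB)// in massA.
rewrite -/(N n h) in massA.
have etaE : eta * (1 + 2 * beta) = z * eps / 4.
  by rewrite /eta divfK// gt_eqF// ltr_pwDl// mulr_ge0.
have zeta_le : eta * (1 + 2 * beta) * v n <= eps / 4 * v k.
  by rewrite etaE -[z * eps / 4]mulrA -mulrA mulrCA ler_pM2l// divr_gt0.
have beta_le : z * eps / 4 * v n <= eps / 4 * v k by rewrite -etaE.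
have betak : beta * (eta * v k) <= beta * (eta * v n).
  by rewrite ler_wpM2l// ler_pM2l.
have zk : 0 <= z * eps / 4 * v k.
  by rewrite mulr_ge0 ?vol_ge0// divr_ge0// mulr_ge0 ?ltW.
have ek : 0 <= eps * v k by rewrite mulr_ge0 ?vol_ge0// ltW.
exact: patch_mass_arith massA massS Nh zeta_le beta_le betak zk ek.
Unshelve. all: by end_near. Qed.

End Densities.

(** * From translates to the hull *)

Section HullDensity.
Variables (R : realType) (G : topGroupType).
Hypothesis hG : hausdorff_space G.
Variable d : G -> G -> R.
Hypothesis Hd : continuous_adapted_metric d.
Variable L : wdelone R G.

(** A bump function lies between the indicators of A and A V, so bounds on A V
    along the orbit control Pi on A. *)
Lemma hull_vol_le (V A : set G) (c : R) Pi : nbhs 1%g V -> compact V ->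
  compact A -> (forall h, vol (comb L) (ltrans h (mulset A V)) <= c) ->
  hull L Pi -> vol Pi A <= c.
Proof.
move=> V1 cV cA Hc LPi; have [r r0 rV] := mball_nbhs Hd V1.
have [f [f01 fA fV]] := bump_exists hG Hd cA r0.
have cAV := compact_mulset cA cV.
have mA := compact_borel hG cA; have mAV := compact_borel hG cAV.
have fAV x : f x != 0 -> mulset A V x.
  move=> /fV[a Aa ax]; exists a => //; exists (a^-1 * x)%g; last by rewrite mulVKg.
  by apply: rV; rewrite /mball /= -(Defs.metric_left_invariant Hd a) mulg1 mulVKg.
have sand mu := pairing_sandwich mA mAV (radon_compact mu cAV) f01 fA fAV.
have /andP[+ _] := sand Pi; move=> /le_trans; apply.
suff : 0 <= radon_pairing Pi f <= c by case/andP.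
apply: hull_pairing LPi => g; have /andP[AP PV] := sand (comb (act g L)).
rewrite (le_trans (vol_ge0 _ _) AP)/=; apply: le_trans PV _.
by rewrite /vol comb_act; exact: Hc.
Qed.

(** Dually, a bump function lies between the indicators of the inverses of the
    erosion and of A. Balls at the identity are symmetric, so that the right
    translations in A^-1 match the left translations defining the erosion. *)
Lemma hull_vol_ge (V A : set G) (c : R) Pi : nbhs 1%g V ->
  compact A -> (forall h, c <= vol (comb L) (ltrans h (invset (erosion V A)))) ->
  hull L Pi -> c <= vol Pi (invset A).
Proof.
move=> V1 cA Hc LPi; have [r r0 rV] := mball_nbhs Hd V1.
have cC : compact (invset (erosion V A)).
  by apply: compact_invset; apply: compact_erosion => //; exact: nbhs_singleton.
have cAi := compact_invset cA.
have [f [f01 fC fV]] := bump_exists hG Hd cC r0.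
have mC := compact_borel hG cC; have mAi := compact_borel hG cAi.
have fA x : f x != 0 -> invset A x.
  move=> /fV[k]; rewrite !invsetE /= => Ck kx.
  have -> : (x^-1 = (x^-1 * k) * k^-1)%g by rewrite mulgK.
  apply: Ck; apply: rV.
  by rewrite /mball /= (Defs.metric_sym Hd) -(Defs.metric_left_invariant Hd x) mulg1 mulVKg.
have sand mu := pairing_sandwich mC mAi (radon_compact mu cAi) f01 fC fA.
have /andP[_] := sand Pi; apply: le_trans.
have [M HM] := comb_translation_bounded L cAi.
suff : c <= radon_pairing Pi f <= M by case/andP.
apply: hull_pairing LPi => g; have /andP[CP PA] := sand (comb (act g L)); apply/andP; split.
  by apply: le_trans CP; rewrite /vol comb_act; exact: Hc.
apply: le_trans PA _; rewrite -lee_fin (EFin_vol hG _ mAi cAi)// comb_act.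
exact: HM.
Qed.

End HullDensity.

Lemma ereal_sup_cvg0 (R : realType) (I : Type) (A : set I) (f : nat -> I -> R) :
  A !=set0 -> (forall n i, 0 <= f n i) ->
  (forall e, 0 < e -> \forall n \near \oo, forall i, A i -> f n i <= e) ->
  ereal_sup [set (f n i)%:E | i in A] @[n --> \oo] --> (0%E : \bar R).
Proof.
move=> [i0 Ai0] f0 H.
have sup_ge0 n : (0 <= ereal_sup [set (f n i)%:E | i in A])%E.
  apply: (@le_trans _ _ (f n i0)%:E); first by rewrite lee_fin.
  by apply: ereal_sup_ubound; exists i0.
have sup_le e n : (forall i, A i -> f n i <= e) ->
    (ereal_sup [set (f n i)%:E | i in A] <= e%:E)%E.
  by move=> He; apply: ge_ereal_sup => _ [i Ai <-]; rewrite lee_fin; exact: He.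
apply/fine_cvgP; split.
  apply: filterS (H 1 ltr01) => n /sup_le nle.
  by rewrite ge0_fin_numE//; exact: le_lt_trans (ltry 1).
apply/cvgrPdist_le => e e0; apply: filterS (H e e0) => n /sup_le nle /=.
rewrite sub0r normrN ger0_norm ?fine_ge0//.
rewrite -lee_fin fineK// ge0_fin_numE//; exact: le_lt_trans (ltry e).
Qed.

Theorem corollary1p5 (R : realType) (G : topGroupType) (HG : lcsc G)
  (Hamen : amenable R G)
  (mG : radon R G) (Hhaar : haar mG) (Hunim : unimodular_haar mG)
  (d : G -> G -> R) (Hd : continuous_adapted_metric d)
  (L : wdelone R G)
  (T : nat -> set G) (HT : strong_folner_exhaustion mG T)
  (Hrep : almost_tempered_repetitive d mG T L) :
  exists b : R,
    ereal_sup [set `|vol Pi (invset (T n)) / vol mG (T n) - b|%:E | Pi in hull L]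
      @[n --> \oo] --> (0%E : \bar R).
Proof.
have [hG _ sG] := HG; have [_ linv] := Hhaar.
have [b [b0 b_inf b_sup]] := upper_density_exists hG HT L.
have lower := repetitive_density_ge hG sG linv Hunim HT b0 b_inf b_sup Hd Hrep.
have erosion_ge := density_erosion_ge hG sG linv Hunim HT b0 b_inf lower.
have cT1 := folner_compact HT (n := 1%N).
have upper e (e0 : 0 < e) := density_le hG sG linv Hunim HT b0 b_inf
  cT1 (ex_intro _ _ (folner_one HT 1%N)) e0.
exists b; apply: ereal_sup_cvg0 => //.
  by exists (comb (act 1%g L)); apply: subset_closure; exists 1%g.
move=> e e0; near=> n; move=> Pi LPi.
have v0 : 0 < vol mG (T n) := folner_vol_gt0 hG HT n.
have cTn := folner_compact HT (n := n).
have nV := folner_nbhs1 HT.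
have up : vol Pi (invset (T n)) <= (b + e) * vol mG (T n).
  apply: (hull_vol_le hG Hd nV cT1 _ _ LPi); first exact: compact_invset.
  by near: n; exact: upper.
have lo : (b - e) * vol mG (T n) <= vol Pi (invset (T n)).
  apply: (hull_vol_ge hG Hd nV cTn _ LPi).
  by near: n; exact: erosion_ge.
by rewrite ler_distl ler_pdivlMr// ler_pdivrMr// lo up.
Unshelve. all: by end_near. Qed.
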